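(* Let $\mathcal{O}_n$ be the Cuntz algebra on $n$ generators $S_1,\dots,S_n$, regarded as the Pimsner algebra of the $\mathrm{C}^*$-correspondence $(\mathbb{C}^n,\phi)$ over $\mathbb{C}$. Let $z_1,\dots,z_n$ be the canonical generating unitaries (coordinate functions) of $\mathrm{C}(\mathbb{T}^n)$ and let $u=\sum_{k=1}^{n}S_kS_k^*\otimes z_k\in\mathcal{O}_n\otimes\mathrm{C}(\mathbb{T}^n)$. The action $\rho$ of $\mathbb{T}^n$ on $\mathcal{O}_n$ given by $$\rho:\mathcal{O}_n\to\mathcal{O}_n\otimes\mathrm{C}(\mathbb{T}^n),\qquad \rho(S_i)=(S_i\otimes1_{\mathrm{C}(\mathbb{T}^n)})u,\quad i=1,\dots,n,$$ is not a lift.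
   Context: Here $n\ge2$, as usual for Cuntz algebras: $\mathcal{O}_n$ is the universal unital $\mathrm{C}^*$-algebra generated by $S_1,\dots,S_n$ with $S_i^*S_j=\delta_{ij}1$ and $\sum_iS_iS_i^*=1$. $\otimes$ is the minimal tensor product of $\mathrm{C}^*$-algebras (or external tensor product of Hilbert modules); $[S]$ is the norm-closed linear span of $S$. A compact quantum group $G$ is a pair $(\mathrm{C}(G),\Delta_G)$ of a unital $\mathrm{C}^*$-algebra and a coassociative unital $*$-homomorphism $\Delta_G:\mathrm{C}(G)\to\mathrm{C}(G)\otimes\mathrm{C}(G)$ with $[\Delta_G(\mathrm{C}(G))(1\otimes\mathrm{C}(G))]=[\Delta_G(\mathrm{C}(G))(\mathrm{C}(G)\otimes1)]=\mathrm{C}(G)\otimes\mathrm{C}(G)$. The torus $\mathbb{T}^n$ is the compact quantum group $(\mathrm{C}(\mathbb{T}^n),\Delta)$ with $\Delta(z_i)=z_i\otimes z_i$. A $G$-$\mathrm{C}^*$-algebra is a pair $(A,\alpha)$ of a unital $\mathrm{C}^*$-algebra and a unital $*$-homomorphism $\alpha:A\to A\otimes\mathrm{C}(G)$ (a $G$-action) with $(\alpha\otimes\mathrm{id})\alpha=(\mathrm{id}\otimes\Delta_G)\alpha$ and $[\alpha(A)(1_A\otimes\mathrm{C}(G))]=A\otimes\mathrm{C}(G)$. A $\mathrm{C}^*$-correspondence over $A$ is a right Hilbert $A$-module $E$ with a unital $*$-homomorphism $\phi:A\to\mathcal{L}(E)$ to the adjointable operators. A $G$-equivariant $\mathrm{C}^*$-correspondence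 over $(A,\alpha)$ is a triple $(E,\phi,\lambda)$ with $(E,\phi)$ a $\mathrm{C}^*$-correspondence over $A$ and $\lambda:E\to E\otimes\mathrm{C}(G)$ linear such that $\lambda(\xi a)=\lambda(\xi)\alpha(a)$, $\langle\lambda(\xi),\lambda(\eta)\rangle=\alpha(\langle\xi,\eta\rangle)$, $(\mathrm{id}_E\otimes\Delta_G)\lambda=(\lambda\otimes\mathrm{id})\lambda$, $[\lambda(E)(1_A\otimes\mathrm{C}(G))]=E\otimes\mathrm{C}(G)$ and $\lambda(\phi(a)\xi)=(\phi\otimes\mathrm{id})(\alpha(a))\lambda(\xi)$. Let $\mathcal{O}_E$ be the Pimsner algebra of a $\mathrm{C}^*$-correspondence $(E,\phi)$ over a unital $\mathrm{C}^*$-algebra $A$, with $E$ finitely generated projective and universal covariant representation $(k_E,k_A)$. An action $\rho:\mathcal{O}_E\to\mathcal{O}_E\otimes\mathrm{C}(G)$ is a lift if there are $\alpha:A\to A\otimes\mathrm{C}(G)$ and $\lambda:E\to E\otimes\mathrm{C}(G)$ such that $(A,\alpha)$ is a $G$-$\mathrm{C}^*$-algebra, $(E,\phi,\lambda)$ is a $G$-equivariant $\mathrm{C}^*$-correspondence over $(A,\alpha)$, and $\rho$ is the (unique) unital $*$-homomorphism satisfying $\rho\circ k_E=(k_E\otimes\mathrm{id}_{\mathrm{C}(G)})\circ\lambda$ and $\rho\circ k_A=(k_A\otimes\mathrm{id}_{\mathrm{C}(G)})\circ\alpha$. For $\mathcal{O}_n$: $A=\mathbb{C}$, $E=\mathbb{C}^n$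 is the Hilbert space with orthonormal basis $e_1,\dots,e_n$, $\phi(c)=c\,\mathrm{id}_E$, $k_A(c)=c1$ and $k_E(e_i)=S_i$ (this is the correspondence of the graph with one vertex and $n$ loops). *)

(* Defs.v *)
From HB Require Import structures.
From mathcomp Require Import all_boot all_order all_algebra.
From mathcomp Require Import complex.
From mathcomp Require Import all_classical all_reals all_analysis.
Import Order.TTheory GRing.Theory Num.Theory.
Import numFieldNormedType.Exports.
Set Implicit Arguments.
Unset Strict Implicit.
Unset Printing Implicit Defensive.
Local Open Scope ring_scope.
Local Open Scope classical_set_scope.

HB.instance Definition _ (R : realType) := NormedModule.copy R[i] R[i]^o.

Section Complex.
Variable R : realType.

Lemma complex_gt0P (e : R[i]) : 0 < e -> exists2 r : R, 0 < r & e = r%:C%C.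
Proof.
case: e => a b; rewrite ltcE /= => /andP[/eqP -> a0].
by exists a.
Qed.

Lemma complex_normE (z : R[i]) : `|z| = (complex.Re `|z|)%:C%C.
Proof. by rewrite RRe_real // normr_real. Qed.

Lemma complex_Re_le (z : R[i]) : (`|complex.Re z|)%:C%C <= `|z|.
Proof. exact: normc_ge_Re. Qed.

Lemma complex_Im_le (z : R[i]) : (`|complex.Im z|)%:C%C <= `|z|.
Proof.
have := complex_Re_le (z * 'i%C); rewrite ReiNIm normrN normrM.
suff -> : `|'i%C : R[i]| = 1 by rewrite mulr1.
by rewrite normc_def /= expr0n /= add0r expr1n sqrtr1.
Qed.

Lemma complex_norm_le (z : R[i]) :
  `|z| <= (`|complex.Re z| + `|complex.Im z|)%:C%C.
Proof.
rewrite {1}(complexE z) (le_trans (ler_normD _ _)) // normrM.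
have -> : `|'i%C : R[i]| = 1.
  by rewrite normc_def /= expr0n /= add0r expr1n sqrtr1.
by rewrite mul1r !normc_def /= !expr0n /= !addr0 !sqrtr_sqr -rmorphD.
Qed.

Lemma complex_complete (F : set_system R[i]) :
  ProperFilter F -> cauchy F -> cvg F.
Proof.
move=> PF /cauchyP FC.
have coord (g : R[i] -> R) : (forall x y, g (x - y) = g x - g y) ->
    (forall z, (`|g z|)%:C%C <= `|z|) -> cvg (g @ F).
  move=> gB gle; apply: R_complete; apply/cauchyP => e e0.
  have [|x Fx] := FC e%:C%C; first by rewrite ltcR.
  exists (g x); suff: F (g @^-1` ball (g x) e) by [].
  apply: filterS Fx => y; rewrite /preimage /= -!ball_normE /ball_ /= => xy.
  by rewrite -gB -ltcR (le_lt_trans (gle _)).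
have /cvg_ex[a /cvgrPdist_lt Fa] : cvg (@complex.Re R @ F).
  by apply: coord => [[? ?] [? ?]|z] //; exact: complex_Re_le.
have /cvg_ex[b /cvgrPdist_lt Fb] : cvg (@complex.Im R @ F).
  by apply: coord => [[? ?] [? ?]|z] //; exact: complex_Im_le.
apply/cvg_ex; exists (a +i* b)%C; apply/cvgrPdist_lt => _ /complex_gt0P[e e0 ->].
near=> z; apply: le_lt_trans (complex_norm_le _) _; rewrite ltcR [e]splitr ltrD //.
  have -> : complex.Re ((a +i* b)%C - z) = a - complex.Re z by case: (z).
  by near: z; apply: Fa; rewrite divr_gt0.
have -> : complex.Im ((a +i* b)%C - z) = b - complex.Im z by case: (z).
by near: z; apply: Fb; rewrite divr_gt0.
Unshelve. all: by end_near. Qed.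

HB.instance Definition _ := Uniform_isComplete.Build R[i] complex_complete.

Lemma circle_compact : compact [set z : R[i] | `|z| = 1].
Proof.
pose g (p : R * R) : R[i] := (p.1 +i* p.2)%C.
have gc : continuous g.
  move=> p; apply/cvgrPdist_lt => _ /complex_gt0P[e e0 ->].
  near=> q; apply: le_lt_trans (complex_norm_le _) _; rewrite ltcR [e]splitr.
  rewrite ltrD //=.
    near: q; apply: (@cvgr_dist_lt _ _ _ _ _ fst p.1); last by rewrite divr_gt0.
    exact: cvg_fst.
  near: q; apply: (@cvgr_dist_lt _ _ _ _ _ snd p.2); last by rewrite divr_gt0.
  exact: cvg_snd.
have K : compact (g @` (`[-1, 1] `*` `[-1, 1])).
  apply: continuous_compact; first exact: continuous_subspaceT.
  by apply: compact_setX; exact: segment_compact.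
apply: subclosed_compact K _.
  rewrite (_ : [set _ | _] = Num.norm @^-1` [set x : R[i] | x = 1]) //.
  apply: (closed_comp (f := Num.norm : R[i] -> R[i])).
    by move=> x _; exact: norm_continuous.
  by apply: accessible_closed_set1; apply: hausdorff_accessible; exact: norm_hausdorff.
move=> z /= z1; exists (complex.Re z, complex.Im z); last by case: z {z1}.
split => /=; rewrite in_itv /= -ler_norml -lecR (_ : 1%:C%C = `|z|) //.
  exact: complex_Re_le.
exact: complex_Im_le.
Unshelve. all: by end_near. Qed.

End Complex.

(* The C*-algebra C(X) of a compact space X, with the supremum norm; x0 *)
(* witnesses that X is nonempty, so that 1 != 0 in C(X).                *)
Definition continuousb (R : realType) (X : topologicalType) :
  {pred X -> R[i]} := [pred f | `[< continuous f >]].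

Definition Cfun (R : realType) (X : topologicalType) (cX : compact [set: X])
  (x0 : X) : Type := {f : X -> R[i] | f \in @continuousb R X}.

Section Cfun.
Variables (R : realType) (X : topologicalType) (cX : compact [set: X]) (x0 : X).
Local Notation K := R[i].
Local Notation CX := (@Cfun R X cX x0).

Definition CfunSub f (fc : f \in @continuousb R X) : CX :=
  exist (fun f => f \in @continuousb R X) f fc.

Lemma continuousb_submod : submod_closed (@continuousb R X).
Proof.
split => [|c f g /asboolP fc /asboolP gc]; apply/asboolP.
  by move=> x; exact: cvg_cst.
move=> x; apply: cvgD; last exact: gc.
by apply: cvgZr; exact: fc.
Qed.

HB.instance Definition _ := GRing.isSubmodClosed.Build _ _ (@continuousb R X)
  continuousb_submod.

HB.instance Definition _ := SubChoice.on CX.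
HB.instance Definition _ := [SubChoice_isSubLmodule of CX by <:].

Lemma Cfun_continuous (f : CX) : continuous (val f).
Proof. by case: f => f /= /asboolP. Qed.

Lemma CfunP (f g : CX) : (forall x, val f x = val g x) -> f = g.
Proof. by move=> fg; apply/val_inj/funext. Qed.

Lemma Cfun_bounded (f : CX) : exists M : R, forall x, complex.Re `|val f x| <= M.
Proof.
have gc : continuous (fun x => complex.Re `|val f x|).
  move=> x; apply/cvgrPdist_lt => e e0.
  have /cvgrPdist_lt/(_ e%:C%C) := @Cfun_continuous f x.
  rewrite ltcR => /(_ e0); apply: filterS => y.
  rewrite -ltcR; apply: le_lt_trans.
  apply: le_trans (ler_dist_dist _ _).
  have -> : complex.Re `|val f x| - complex.Re `|val f y| =
    complex.Re (`|val f x| - `|val f y|) by case: `|_| `|val f y| => [? ?] [? ?].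
  exact: complex_Re_le.
have /compact_bounded[M [_ /(_ (M + 1))]] : compact ((fun x => complex.Re `|val f x|) @` [set: X]).
  by apply: continuous_compact => //; exact: continuous_subspaceT.
rewrite ltrDl ltr01 => /(_ isT) H; exists (M + 1) => x.
by apply: le_trans (ler_norm _) _; apply: H; exists x.
Qed.

Definition Cnorm (f : CX) : K :=
  (sup [set complex.Re `|val f x| | x in [set: X]])%:C%C.

Lemma Cnorm_ub (f : CX) x : `|val f x| <= Cnorm f.
Proof.
rewrite complex_normE lecR; apply: ub_le_sup; last by exists x.
by have [M fM] := Cfun_bounded f; exists M => _ [y _ <-].
Qed.

Lemma Cnorm_le (f : CX) (M : K) : (forall x, `|val f x| <= M) -> Cnorm f <= M.
Proof.
move=> fM; have M0 : 0 <= M by apply: le_trans (fM x0).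
have ME : M = (complex.Re M)%:C%C by rewrite RRe_real // ger0_real.
rewrite ME lecR; apply: ge_sup; first by exists (complex.Re `|val f x0|), x0.
by move=> _ [y _ <-]; rewrite -lecR -ME -complex_normE.
Qed.

Lemma Cnorm_ge0 f : 0 <= Cnorm f.
Proof. exact: le_trans (Cnorm_ub f x0). Qed.

Lemma CnormD f g : Cnorm (f + g) <= Cnorm f + Cnorm g.
Proof.
apply: Cnorm_le => x; apply: le_trans (ler_normD _ _) _.
by rewrite lerD // Cnorm_ub.
Qed.

Lemma CnormZ (c : K) f : Cnorm (c *: f) = `|c| * Cnorm f.
Proof.
apply/eqP; rewrite eq_le; apply/andP; split.
  by apply: Cnorm_le => x; rewrite normrM ler_wpM2l // Cnorm_ub.
have [->|c0] := eqVneq c 0; first by rewrite normr0 mul0r Cnorm_ge0.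
rewrite mulrC -ler_pdivlMr ?normr_gt0 //; apply: Cnorm_le => x.
rewrite ler_pdivlMr ?normr_gt0 // mulrC -normrM.
exact: (Cnorm_ub (c *: f)).
Qed.

Lemma Cnorm0_eq0 f : Cnorm f = 0 -> f = 0.
Proof.
move=> f0; apply: CfunP => x; apply/eqP; rewrite -normr_le0 -f0.
exact: Cnorm_ub.
Qed.

HB.instance Definition _ :=
  Lmodule_isNormed.Build K CX CnormD CnormZ Cnorm0_eq0.

Lemma Cfun_normE (f : CX) : `|f| = Cnorm f. Proof. by []. Qed.

Lemma Cfun_complete (F : set_system CX) : ProperFilter F -> cauchy F -> cvg F.
Proof.
move=> PF /cauchyP FC.
have FCx x : cvg ((fun f : CX => val f x) @ F).
  apply: complex_complete; apply/cauchyP => e e0; have [f Ff] := FC e e0.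
  exists (val f x); suff: F ((fun f : CX => val f x) @^-1` ball (val f x) e) by [].
  apply: filterS Ff => g; rewrite /preimage /= -!ball_normE /ball_ /= => fg.
  exact: le_lt_trans (Cnorm_ub (f - g) x) fg.
pose l x : K := lim ((fun f : CX => val f x) @ F).
have lP e : 0 < e -> exists f, F (ball f e) /\ forall x, `|val f x - l x| <= e.
  move=> e0; have [f Ff] := FC e e0; exists f; split => // x.
  apply/ler_addgt0Pr => d d0.
  have /cvgrPdist_lt/(_ d d0) lx := FCx x.
  have [g [fg /= lg]] := @filter_ex _ _ PF _ (filterI Ff lx).
  move: fg; rewrite -ball_normE /ball_ /= => fg.
  rewrite -(subrKA (val g x)) (le_trans (ler_normD _ _)) // lerD //.
    exact: le_trans (Cnorm_ub (f - g) x) (ltW fg).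
  by rewrite distrC ltW.
have lc : continuous l.
  move=> x; apply/cvgrPdist_lt => e e0.
  have e3 : 0 < e / 3%:R by rewrite divr_gt0.
  have [f [_ fl]] := lP _ e3.
  have /cvgrPdist_lt/(_ _ e3) := @Cfun_continuous f x.
  apply: filterS => y fxy.
  rewrite -(subrKA (val f x)) (le_lt_trans (ler_normD _ _)) //.
  rewrite (_ : e = e / 3%:R + (e / 3%:R + e / 3%:R)); last first.
    by rewrite -mulr2n -mulrS -(mulr_natr (e / 3%:R) 3) divfK // pnatr_eq0.
  rewrite ler_ltD //; first by rewrite distrC.
  rewrite -(subrKA (val f y)) (le_lt_trans (ler_normD _ _)) //.
  by rewrite ltr_leD.
pose L : CX := exist _ l (asboolT lc).
apply/cvg_ex; exists L; apply/cvgrPdist_lt => e e0.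
have e2 : 0 < e / 2%:R by rewrite divr_gt0.
have [f [Ff fl]] := lP _ e2.
apply: filterS Ff => g; rewrite -ball_normE /ball_ /= => fg.
rewrite -(subrKA f) (le_lt_trans (ler_normD _ _)) // [e]splitr ler_ltD //.
rewrite Cfun_normE; apply: Cnorm_le => x.
by change (`|l x - val f x| <= e / 2%:R); rewrite distrC; exact: fl.
Qed.

HB.instance Definition _ := Uniform_isComplete.Build CX Cfun_complete.

Lemma Cfun1_subproof : (fun _ : X => 1 : K) \in @continuousb R X.
Proof. by apply/asboolP => x; exact: cvg_cst. Qed.
Definition Cfun1 : CX := CfunSub Cfun1_subproof.

Lemma Cfun_mul_subproof (f g : CX) :
  (fun x => val f x * val g x) \in @continuousb R X.
Proof.
by apply/asboolP => x; apply: cvgM; apply: Cfun_continuous.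
Qed.
Definition Cfun_mul (f g : CX) : CX := CfunSub (Cfun_mul_subproof f g).

Lemma Cfun_star_subproof (f : CX) :
  (fun x => (val f x)^*) \in @continuousb R X.
Proof.
apply/asboolP => x; apply/cvgrPdist_lt => e e0.
have /cvgrPdist_lt/(_ e e0) := @Cfun_continuous f x.
by apply: filterS => y; rewrite -rmorphB norm_conjC.
Qed.
Definition Cfun_star (f : CX) : CX := CfunSub (Cfun_star_subproof f).

Lemma Cfun_normM f g : `|Cfun_mul f g| <= `|f| * `|g|.
Proof.
by apply: Cnorm_le => x; rewrite normrM ler_pM // Cnorm_ub.
Qed.

Lemma Cfun_norm_star f : `|Cfun_mul (Cfun_star f) f| = `|f| ^+ 2.
Proof.
apply/eqP; rewrite eq_le; apply/andP; split.
  apply: Cnorm_le => x /=; rewrite normrM norm_conjC -expr2.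
  by rewrite ler_pXn2r ?nnegrE // Cnorm_ub.
have N0 : 0 <= `|Cfun_mul (Cfun_star f) f| by [].
rewrite -(sqrtCK `|Cfun_mul _ _|) ler_pXn2r ?nnegrE ?sqrtC_ge0 //.
apply: Cnorm_le => x.
rewrite -(@ler_pXn2r _ 2) ?nnegrE ?sqrtC_ge0 // sqrtCK.
rewrite expr2 -{1}norm_conjC -normrM.
exact: (Cnorm_ub (Cfun_mul (Cfun_star f) f)).
Qed.

End Cfun.

(* Unital C*-algebras.  As for all MathComp rings, 1 != 0 is required. *)
Record cstarAlg (R : realType) := CstarAlg {
  cstar_car : completeNormedModType R[i];
  cstar_one : cstar_car;
  cstar_mul : cstar_car -> cstar_car -> cstar_car;
  cstar_star : cstar_car -> cstar_car;
  cstar_mulA : associative cstar_mul;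
  cstar_mul1r : left_id cstar_one cstar_mul;
  cstar_mulr1 : right_id cstar_one cstar_mul;
  cstar_mulDl : left_distributive cstar_mul +%R;
  cstar_mulDr : right_distributive cstar_mul +%R;
  cstar_scaleAl : forall (c : R[i]) x y,
    c *: cstar_mul x y = cstar_mul (c *: x) y;
  cstar_scaleAr : forall (c : R[i]) x y,
    c *: cstar_mul x y = cstar_mul x (c *: y);
  cstar_one_neq0 : cstar_one != 0;
  cstar_starK : involutive cstar_star;
  cstar_starD : {morph cstar_star : x y / x + y};
  cstar_starZ : forall (c : R[i]) x,
    cstar_star (c *: x) = c^* *: cstar_star x;
  cstar_starM : forall x y,
    cstar_star (cstar_mul x y) = cstar_mul (cstar_star y) (cstar_star x);
  cstar_normM : forall x y, `|cstar_mul x y| <= `|x| * `|y|;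
  cstar_normE : forall x, `|cstar_mul (cstar_star x) x| = `|x| ^+ 2
}.

Definition cstar_sort (R : realType) (A : cstarAlg R) : Type := cstar_car A.
Coercion cstar_sort : cstarAlg >-> Sortclass.

Section CstarInstances.
Variables (R : realType) (A : cstarAlg R).
HB.instance Definition _ := CompleteNormedModule.copy (cstar_sort A) (cstar_car A).
HB.instance Definition _ := GRing.Zmodule_isNzRing.Build (cstar_sort A)
  (@cstar_mulA R A) (@cstar_mul1r R A) (@cstar_mulr1 R A)
  (@cstar_mulDl R A) (@cstar_mulDr R A) (@cstar_one_neq0 R A).
HB.instance Definition _ := GRing.Lmodule_isLalgebra.Build R[i] (cstar_sort A)
  (@cstar_scaleAl R A).
HB.instance Definition _ := GRing.Lalgebra_isAlgebra.Build R[i] (cstar_sort A)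
  (@cstar_scaleAr R A).
Definition star (x : A) : A := cstar_star x.
End CstarInstances.

(* Right Hilbert A-modules: hact x a is x a, and the A-valued inner product *)
(* hip x y is linear in y.                                                  *)
Record hilbertModule (R : realType) (A : cstarAlg R) := HilbertModule {
  hilb_sort :> completeNormedModType R[i];
  hact : hilb_sort -> A -> hilb_sort;
  hip : hilb_sort -> hilb_sort -> A;
  hactDl : forall x y a, hact (x + y) a = hact x a + hact y a;
  hactDr : forall x a b, hact x (a + b) = hact x a + hact x b;
  hactZl : forall (c : R[i]) x a, hact (c *: x) a = c *: hact x a;
  hactZr : forall (c : R[i]) x a, hact x (c *: a) = c *: hact x a;
  hactM : forall x a b, hact x (a * b) = hact (hact x a) b;
  hact1 : forall x, hact x 1 = x;
  hipD : forall x y z, hip x (y + z) = hip x y + hip x z;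
  hipZ : forall (c : R[i]) x y, hip x (c *: y) = c *: hip x y;
  hipM : forall x y a, hip x (hact y a) = hip x y * a;
  hip_star : forall x y, hip y x = star (hip x y);
  hip_ge0 : forall x, exists a, hip x x = star a * a;
  hip_norm : forall x, `|hip x x| = `|x| ^+ 2
}.

Section Complex.
Variable R : realType.
Local Notation K := R[i].

Lemma complex_norm_star (z : K) : `|z^* * z| = `|z| ^+ 2.
Proof. by rewrite normrM norm_conjC expr2. Qed.

Definition complexAlg : cstarAlg R.
Proof.
refine (@CstarAlg R K 1 *%R (fun z => z^*) _ _ _ _ _ _ _ _ _ _ _ _ _ _).
- exact: mulrA.
- exact: mul1r.
- exact: mulr1.
- exact: mulrDl.
- exact: mulrDr.
- by move=> c x y; exact: mulrA.
- by move=> c x y; exact: mulrCA.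
- exact: oner_neq0.
- exact: conjCK.
- exact: rmorphD.
- by move=> c x; exact: rmorphM.
- by move=> x y; rewrite rmorphM mulrC.
- by move=> x y; rewrite normrM.
- exact: complex_norm_star.
Defined.

End Complex.

(* C^n with its Euclidean norm; 'rV itself carries the maximum norm. *)
Definition euclid (R : realType) (n : nat) : Type := 'rV[R[i]]_n.

Section Euclid.
Variables (R : realType) (n : nat).
Local Notation K := R[i].
Local Notation Kn := (euclid R n).
HB.instance Definition _ := GRing.Lmodule.copy Kn 'rV[K]_n.

Definition euclid_norm (x : Kn) : K := sqrtC (\sum_i `|x 0 i| ^+ 2).

Lemma euclid_sum_ge0 (x : Kn) : 0 <= \sum_i `|x 0 i| ^+ 2.
Proof. by apply: sumr_ge0 => i _; rewrite exprn_ge0. Qed.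

Lemma euclid_norm_dot (x : Kn) : euclid_norm x = sqrtC (dotmx x x).
Proof.
congr sqrtC; rewrite dotmxE !mxE; apply: eq_bigr => i _.
by rewrite !mxE normCK.
Qed.

Lemma euclid_normD (x y : Kn) :
  euclid_norm (x + y) <= euclid_norm x + euclid_norm y.
Proof. by rewrite !euclid_norm_dot (triangle_lerif (@dotmx _ n) x y). Qed.

Lemma euclid_normZ (c : K) (x : Kn) : euclid_norm (c *: x) = `|c| * euclid_norm x.
Proof.
rewrite /euclid_norm -[`|c|]sqrCK // -rootCMl ?exprn_ge0 // mulr_sumr.
by congr sqrtC; apply: eq_bigr => i _; rewrite mxE normrM exprMn.
Qed.

Lemma euclid_coord_le (x : Kn) i : `|x 0 i| <= euclid_norm x.
Proof.
rewrite -[leLHS]sqrCK // ler_sqrtC ?nnegrE ?exprn_ge0 ?euclid_sum_ge0 //.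
rewrite (bigD1 i) //= lerDl; apply: sumr_ge0 => j _; exact: exprn_ge0.
Qed.

Lemma euclid_norm0_eq0 (x : Kn) : euclid_norm x = 0 -> x = 0.
Proof.
move=> x0; apply/rowP => i; apply/eqP; rewrite mxE -normr_le0 -x0.
exact: euclid_coord_le.
Qed.

HB.instance Definition _ :=
  Lmodule_isNormed.Build K Kn euclid_normD euclid_normZ euclid_norm0_eq0.

Lemma euclid_norm_le (x : Kn) : `|x| <= \sum_i `|x 0 i|.
Proof.
rewrite -[leRHS]sqrCK ?sumr_ge0 // ler_sqrtC ?nnegrE ?euclid_sum_ge0 ?exprn_ge0 ?sumr_ge0 //.
have [] // : 0 <= \sum_i `|x 0 i| /\
    \sum_i `|x 0 i| ^+ 2 <= (\sum_i `|x 0 i|) ^+ 2.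
elim/big_rec2 : _ => [|i a b _ [a0 ba]]; first by rewrite expr0n.
split; first by rewrite addr_ge0.
rewrite sqrrD addrAC; apply: (@le_trans _ _ (`|x 0 i| ^+ 2 + b ^+ 2)).
    by rewrite lerD2l.
by rewrite lerDl mulrn_wge0 // mulr_ge0.
Qed.

Lemma euclid_complete (F : set_system Kn) : ProperFilter F -> cauchy F -> cvg F.
Proof.
move=> PF /cauchyP FC.
have FCi i : cvg ((fun x : Kn => x 0 i) @ F).
  apply: complex_complete; apply/cauchyP => e e0; have [x Fx] := FC e e0.
  exists (x 0 i); suff: F ((fun x : Kn => x 0 i) @^-1` ball (x 0 i) e) by [].
  apply: filterS Fx => y; rewrite /preimage /= -!ball_normE /ball_ /= => xy.
  by apply: le_lt_trans xy; have := euclid_coord_le (x - y) i; rewrite !mxE.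
pose l : Kn := \row_i lim ((fun x : Kn => x 0 i) @ F).
apply/cvg_ex; exists l; apply/cvgrPdist_lt => e e0.
have en : 0 < e / n.+1%:R by rewrite divr_gt0.
have : F [set x : Kn | forall i : 'I_n, `|l 0 i - x 0 i| < e / n.+1%:R].
  apply: filter_forall => i; have /cvgrPdist_lt/(_ _ en) := FCi i.
  by rewrite mxE.
apply: filterS => x lx; apply: le_lt_trans (euclid_norm_le _) _.
apply: (@le_lt_trans _ _ (\sum_(i < n) e / n.+1%:R)).
  by apply: ler_sum => i _; rewrite !mxE; have := lx i; rewrite mxE => /ltW.
rewrite sumr_const card_ord -(mulr_natr (e / n.+1%:R) n) -mulrA gtr_pMr // mulrC ltr_pdivrMr //.
by rewrite mul1r ltr_nat.
Qed.

HB.instance Definition _ := Uniform_isComplete.Build Kn euclid_complete.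

Definition euclid_hilb : hilbertModule (complexAlg R).
Proof.
refine (@HilbertModule R (complexAlg R) Kn (fun x c => (c : K) *: x)
  (fun x y => \sum_i (x 0 i)^* * y 0 i) _ _ _ _ _ _ _ _ _ _ _ _).
- by move=> x y a; exact: scalerDr.
- by move=> x a b; exact: scalerDl.
- by move=> c x a; rewrite !scalerA mulrC.
- by move=> c x a; rewrite scalerA.
- by move=> x a b; rewrite scalerA mulrC.
- by move=> x; exact: scale1r.
- move=> x y z; rewrite -big_split /=; apply: eq_bigr => i _.
  by rewrite mxE mulrDr.
- move=> c x y; rewrite scaler_sumr; apply: eq_bigr => i _.
  by rewrite mxE mulrCA.
- move=> x y a; rewrite mulr_suml; apply: eq_bigr => i _.
  by rewrite mxE mulrCA mulrC.
- move=> x y; rewrite /star /= rmorph_sum; apply: eq_bigr => i _.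
  by rewrite rmorphM /= conjCK mulrC.
- move=> x; exists (euclid_norm x).
  rewrite /star /= conj_Creal ?ger0_real ?sqrtC_ge0 ?euclid_sum_ge0 //.
  rewrite -[RHS]expr2 sqrtCK; apply: eq_bigr => i _.
  by rewrite normCK mulrC.
- move=> x; rewrite sqrtCK -[RHS]ger0_norm ?euclid_sum_ge0 //; congr Num.norm.
  by apply: eq_bigr => i _; rewrite normCK mulrC.
Defined.
End Euclid.

Definition CfunAlg (R : realType) (X : topologicalType)
  (cX : compact [set: X]) (x0 : X) : cstarAlg R.
Proof.
refine (@CstarAlg R (@Cfun R X cX x0) (Cfun1 R cX x0) (@Cfun_mul R X cX x0)
  (@Cfun_star R X cX x0) _ _ _ _ _ _ _ _ _ _ _ _ _ _).
- by move=> f g h; apply: CfunP => x /=; rewrite mulrA.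
- by move=> f; apply: CfunP => x /=; rewrite mul1r.
- by move=> f; apply: CfunP => x /=; rewrite mulr1.
- by move=> f g h; apply: CfunP => x /=; rewrite mulrDl.
- by move=> f g h; apply: CfunP => x /=; rewrite mulrDr.
- by move=> c f g; apply: CfunP => x; exact: mulrA.
- by move=> c f g; apply: CfunP => x; exact: mulrCA.
- apply/eqP => /(congr1 (fun f => val f x0)) /eqP; exact/negP/oner_neq0.
- by move=> f; apply: CfunP => x /=; rewrite conjCK.
- by move=> f g; apply: CfunP => x; exact: rmorphD.
- by move=> c f; apply: CfunP => x; exact: rmorphM.
- by move=> f g; apply: CfunP => x /=; rewrite rmorphM mulrC.
- exact: Cfun_normM.
- exact: Cfun_norm_star.
Defined.

Lemma compact_set_type (X : topologicalType) (A : set X) :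
  compact A -> compact [set: set_type A].
Proof.
move=> cA F PF _.
have PG : ProperFilter (set_val @ F) by exact: fmap_proper_filter.
have GA : (set_val @ F) A.
  by apply: (@filterS _ F _ setT) => [[x /= xA] _|]; [exact/set_mem|exact: filterT].
have [p [Ap clp]] := cA _ PG GA.
exists (SigSub (mem_set Ap)); split => // B C FB.
rewrite nbhsE => -[D [[V oV <-] /= Vp] DC].
have [||q [Bq Vq]] := clp (set_val @` B) V.
- suff: F (set_val @^-1` (set_val @` B)) by [].
  by apply: filterS FB => x Bx; exists x.
- apply: (@open_nbhs_nbhs X p V); split; [exact: oV|exact: Vp].
case: Bq Vq => r Br <- Vr; exists r; split => //; exact: DC.
Qed.

Definition torus (R : realType) (n : nat) : set 'rV[R[i]]_n :=
  [set v | forall i, `|v 0 i| = 1].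

Lemma torus_compact (R : realType) (n : nat) :
  compact [set: set_type (@torus R n)].
Proof.
apply: compact_set_type.
exact: (@rV_compact R[i] n (fun=> [set z : R[i] | `|z| = 1])
  (fun=> @circle_compact R)).
Qed.

Lemma torus1_subproof (R : realType) (n : nat) :
  const_mx 1 \in @torus R n.
Proof. by apply/mem_set => i; rewrite mxE normr1. Qed.

Definition torusAlg (R : realType) (n : nat) : cstarAlg R :=
  CfunAlg R (@torus_compact R n) (SigSub (@torus1_subproof R n)).

Lemma torus_coord_subproof (R : realType) (n : nat) (i : 'I_n) :
  (fun v : set_type (@torus R n) => set_val v 0 i) \in
    @continuousb R (set_type (@torus R n)).
Proof.
apply/asboolP => v.
apply: (@continuous_comp _ _ _ set_val (fun v : 'rV[R[i]]_n => v 0 i)).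
  exact: initial_continuous.
exact: coord_continuous.
Qed.

Definition torus_coord (R : realType) (n : nat) (i : 'I_n) : torusAlg R n :=
  CfunSub _ _ (@torus_coord_subproof R n i).

Section Basic.
Variable R : realType.
Local Notation K := R[i].

Definition linear_map (V W : lmodType K) (f : V -> W) : Prop :=
  forall (c : K) x y, f (c *: x + y) = c *: f x + f y.

Definition unital_star_hom (A B : cstarAlg R) (f : A -> B) : Prop :=
  [/\ linear_map f, f 1 = 1, (forall x y, f (x * y) = f x * f y)
    & (forall x, f (star x) = star (f x))].

Definition lspan (V : lmodType K) (S : set V) : set V :=
  [set x | exists m (c : 'I_m -> K) (s : 'I_m -> V),
     (forall i, S (s i)) /\ x = \sum_i c i *: s i].

Definition cspan (V : normedModType K) (S : set V) : set V :=
  closure (lspan S).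

(* A unital *-homomorphism from A to the adjointable operators of E.  A map *)
(* with an adjoint is automatically linear and B-linear.                    *)
Definition is_representation (A B : cstarAlg R) (E : hilbertModule B)
    (phi : A -> E -> E) : Prop :=
  [/\ (forall a x y, hip (phi a x) y = hip x (phi (star a) y)),
      (forall (c : K) a b x, phi (c *: a + b) x = c *: phi a x + phi b x),
      (forall x, phi 1 x = x)
    & (forall a b x, phi (a * b) x = phi a (phi b x))].

Definition hilbertSpace := hilbertModule (complexAlg R).

(* The square of the norm of the vector \sum_(p <- s) p.1 (x) p.2 of the *)
(* Hilbert space tensor product of H1 and H2.                           *)
Definition tensor_sqnorm (H1 H2 : hilbertSpace) (s : seq (H1 * H2)) : K :=
  \sum_(p <- s) \sum_(q <- s) (hip p.1 q.1 : K) * (hip p.2 q.2 : K).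

(* The operator \sum_(a <- t) pi a.1 (x) sigma a.2 on the Hilbert space *)
(* tensor product of H1 and H2 has norm at most M.                      *)
Definition tensor_opnorm_le (A B : cstarAlg R) (H1 H2 : hilbertSpace)
    (pi : A -> H1 -> H1) (sigma : B -> H2 -> H2) (t : seq (A * B)) (M : K) :
    Prop :=
  forall s : seq (H1 * H2),
    tensor_sqnorm [seq (pi a.1 x.1, sigma a.2 x.2) | a <- t, x <- s]
      <= M ^+ 2 * tensor_sqnorm s.

(* T, with p a b for a (x) b, is the completion of the algebraic tensor     *)
(* product of A and B for the minimal (spatial) norm, the supremum of the   *)
(* norms of (pi (x) sigma)(t) over all representations pi of A, sigma of B. *)
Record is_min_tensor (A B T : cstarAlg R) (p : A -> B -> T) : Prop := {
  min_tensor_linl : forall b, linear_map (p^~ b);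
  min_tensor_linr : forall a, linear_map (p a);
  min_tensor1 : p 1 1 = 1;
  min_tensorM : forall a a' b b', p (a * a') (b * b') = p a b * p a' b';
  min_tensor_star : forall a b, p (star a) (star b) = star (p a b);
  min_tensor_inj : forall m (a : 'I_m -> A) (b : 'I_m -> B),
    (forall c : 'I_m -> K, \sum_i c i *: a i = 0 -> forall i, c i = 0) ->
    \sum_i p (a i) (b i) = 0 -> forall i, b i = 0;
  min_tensor_dense : cspan [set x | exists a b, x = p a b] = setT;
  min_tensor_norm_ub : forall (t : seq (A * B)) (H1 H2 : hilbertSpace)
      (pi : A -> H1 -> H1) (sigma : B -> H2 -> H2),
    is_representation pi -> is_representation sigma ->
    tensor_opnorm_le pi sigma t `|\sum_(a <- t) p a.1 a.2|;
  min_tensor_norm_lub : forall (t : seq (A * B)) (M : K), 0 <= M ->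
    (forall (H1 H2 : hilbertSpace)
        (pi : A -> H1 -> H1) (sigma : B -> H2 -> H2),
      is_representation pi -> is_representation sigma ->
      tensor_opnorm_le pi sigma t M) ->
    `|\sum_(a <- t) p a.1 a.2| <= M
}.

(* F, with q x b for x (x) b, is the external tensor product of E with the *)
(* Hilbert B-module B, where p a b stands for a (x) b.                     *)
Record is_ext_tensor (A B T : cstarAlg R) (p : A -> B -> T)
    (E : hilbertModule A) (F : hilbertModule T) (q : E -> B -> F) : Prop := {
  ext_tensor_linl : forall b, linear_map (q^~ b);
  ext_tensor_linr : forall x, linear_map (q x);
  ext_tensor_act : forall x b a b', hact (q x b) (p a b') = q (hact x a) (b * b');
  ext_tensor_ip : forall x b x' b',
    hip (q x b) (q x' b') = p (hip x x') (star b * b');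
  ext_tensor_dense : cspan [set y | exists x b, y = q x b] = setT
}.

(* A choice of the tensor products, which are only defined up to unique     *)
(* isomorphism, together with the identifications of A (x) (B (x) D) with   *)
(* (A (x) B) (x) D and of E (x) (B (x) D) with (E (x) B) (x) D.             *)
Record tensorProduct := TensorProduct {
  tens : cstarAlg R -> cstarAlg R -> cstarAlg R;
  tpure : forall A B : cstarAlg R, A -> B -> tens A B;
  tpureP : forall A B : cstarAlg R, is_min_tensor (@tpure A B);
  tassoc : forall A B D : cstarAlg R, tens A (tens B D) -> tens (tens A B) D;
  tassoc_hom : forall A B D : cstarAlg R, unital_star_hom (@tassoc A B D);
  tassocE : forall (A B D : cstarAlg R) (a : A) (b : B) (d : D),
    tassoc (tpure a (tpure b d)) = tpure (tpure a b) d;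
  htens : forall (A : cstarAlg R) (E : hilbertModule A) (B : cstarAlg R), hilbertModule (tens A B);
  hpure : forall (A : cstarAlg R) (E : hilbertModule A) (B : cstarAlg R), E -> B -> htens E B;
  hpureP : forall (A : cstarAlg R) (E : hilbertModule A) (B : cstarAlg R),
    is_ext_tensor (@tpure A B) (@hpure A E B);
  hassoc : forall (A : cstarAlg R) (E : hilbertModule A) (B : cstarAlg R) D,
    htens E (tens B D) -> htens (htens E B) D;
  hassoc_lin : forall (A : cstarAlg R) (E : hilbertModule A) (B : cstarAlg R) D,
    linear_map (@hassoc A E B D);
  hassoc_ip : forall (A : cstarAlg R) (E : hilbertModule A) (B : cstarAlg R) D (x y : htens E (tens B D)),
    hip (hassoc x) (hassoc y) = tassoc (hip x y);
  hassocE : forall A (E : hilbertModule A) (B D : cstarAlg R)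
      (x : E) (b : B) (d : D),
    hassoc (hpure x (tpure b d)) = hpure (hpure x b) d
}.

(* The continuous linear map with h a b as the image of a (x) b, which is *)
(* unique when the vectors p a b span a dense subspace.                   *)
Definition tensor_ext (A B : Type) (V W : normedModType K)
    (p : A -> B -> V) (h : A -> B -> W) : V -> W :=
  xget (fun=> 0)
    [set F | [/\ linear_map F, continuous F & forall a b, F (p a b) = h a b]].

End Basic.

Section Actions.
Variables (R : realType) (t : tensorProduct R).
Local Notation K := R[i].

Definition tmap (A A' B B' : cstarAlg R) (f : A -> A') (g : B -> B') :
    tens t A B -> tens t A' B' :=
  tensor_ext (@tpure R t A B) (fun a b => tpure t (f a) (g b)).

Definition hmap (A A' B B' : cstarAlg R) (E : hilbertModule A)
    (E' : hilbertModule A') (f : E -> E') (g : B -> B') :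
    htens t E B -> htens t E' B' :=
  tensor_ext (@hpure R t A E B) (fun x b => hpure t (f x) (g b)).

Definition hmap_alg (A O B B' : cstarAlg R) (E : hilbertModule A)
    (f : E -> O) (g : B -> B') : htens t E B -> tens t O B' :=
  tensor_ext (@hpure R t A E B) (fun x b => tpure t (f x) (g b)).

(* (phi (x) id)(x) y for the induced representation phi (x) id of A (x) B *)
(* on E (x) B.                                                            *)
Definition amplify (A D B : cstarAlg R) (E : hilbertModule D)
    (phi : A -> E -> E) (x : tens t A B) (y : htens t E B) : htens t E B :=
  tensor_ext (@tpure R t A B)
    (fun a b => tensor_ext (@hpure R t D E B)
       (fun xi c => hpure t (phi a xi) (b * c)) y) x.

(* In the next three records tassoc and hassoc only implement the usual *)
(* identification of the two ways of bracketing a triple tensor product. *)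
Record is_quantum_group (B : cstarAlg R) (Delta : B -> tens t B B) : Prop := {
  qgroup_hom : unital_star_hom Delta;
  qgroup_coassoc : forall x,
    tmap Delta idfun (Delta x) = tassoc (tmap idfun Delta (Delta x));
  qgroup_densel :
    cspan [set x | exists b c, x = Delta b * tpure t 1 c] = setT;
  qgroup_denser :
    cspan [set x | exists b c, x = Delta b * tpure t c 1] = setT
}.

Record is_action (B : cstarAlg R) (Delta : B -> tens t B B)
    (A : cstarAlg R) (alpha : A -> tens t A B) : Prop := {
  action_hom : unital_star_hom alpha;
  action_coassoc : forall a,
    tmap alpha idfun (alpha a) = tassoc (tmap idfun Delta (alpha a));
  action_dense :
    cspan [set x | exists a b, x = alpha a * tpure t 1 b] = setT
}.

Record is_equivariant_correspondence (B : cstarAlg R) (Delta : B -> tens t B B)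
    (A : cstarAlg R) (alpha : A -> tens t A B) (E : hilbertModule A)
    (phi : A -> E -> E) (lambda : E -> htens t E B) : Prop := {
  corr_rep : is_representation phi;
  corr_linear : linear_map lambda;
  corr_act : forall x a, lambda (hact x a) = hact (lambda x) (alpha a);
  corr_ip : forall x y, hip (lambda x) (lambda y) = alpha (hip x y);
  corr_coassoc : forall x,
    hassoc (hmap idfun Delta (lambda x)) = hmap lambda idfun (lambda x);
  corr_dense :
    cspan [set y | exists x b, y = hact (lambda x) (tpure t 1 b)] = setT;
  corr_phi : forall a x, lambda (phi a x) = amplify phi (alpha a) (lambda x)
}.

(* Here (kE, kA) is the universal covariant representation of (E, phi) in *)
(* its Pimsner algebra O.                                                 *)
Definition is_lift (B : cstarAlg R) (Delta : B -> tens t B B)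
    (A : cstarAlg R) (E : hilbertModule A) (phi : A -> E -> E)
    (O : cstarAlg R) (kE : E -> O) (kA : A -> O)
    (rho : O -> tens t O B) : Prop :=
  exists (alpha : A -> tens t A B) (lambda : E -> htens t E B),
    [/\ is_action Delta alpha,
        is_equivariant_correspondence Delta alpha phi lambda,
        unital_star_hom rho,
        (forall x, rho (kE x) = hmap_alg kE idfun (lambda x))
      & (forall a, rho (kA a) = tmap kA idfun (alpha a))].

End Actions.

Section Cuntz.
Variables (R : realType) (n : nat).
Local Notation K := R[i].

Definition cuntz_relations (A : cstarAlg R) (S : 'I_n -> A) : Prop :=
  (forall i j, star (S i) * S j = (i == j)%:R) /\ \sum_i S i * star (S i) = 1.

Record is_cuntz (O : cstarAlg R) (S : 'I_n -> O) : Prop := {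
  cuntz_rel : cuntz_relations S;
  cuntz_generated : forall D : set O, closed D -> D 1 ->
    (forall (c : K) x y, D x -> D y -> D (c *: x + y)) ->
    (forall x y, D x -> D y -> D (x * y)) ->
    (forall x, D x -> D (star x)) ->
    (forall i, D (S i)) -> D = setT;
  cuntz_universal : forall (A : cstarAlg R) (T : 'I_n -> A),
    cuntz_relations T ->
    exists! f : O -> A, unital_star_hom f /\ forall i, f (S i) = T i
}.

Definition cuntz_phi (c : complexAlg R) (x : euclid_hilb R n) :
  euclid_hilb R n := (c : K) *: x.

Definition cuntz_kA (O : cstarAlg R) (c : complexAlg R) : O := (c : K)%:A.

Definition cuntz_kE (O : cstarAlg R) (S : 'I_n -> O) (x : euclid_hilb R n) :
  O := \sum_i (x : 'rV[K]_n) 0 i *: S i.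

Definition cuntz_unitary (t : tensorProduct R) (O : cstarAlg R)
    (S : 'I_n -> O) : tens t O (torusAlg R n) :=
  \sum_k tpure t (S k * star (S k)) (@torus_coord R n k).

End Cuntz.

(* Main.v *)
(* Put P_k = S_k S_k^*.  Since u is unitary, the elements (S_i (x) 1) u satisfy
   the Cuntz relations, so rho exists and is unique by universality; the same
   uniqueness reduces coassociativity to rho(S_i P_k) = S_i P_k (x) z_k.  The
   closed span X of rho(O_n)(1 (x) C(T^n)) is a C*-algebra because
   1 (x) C(T^n) is central, and it contains
   S_i (x) 1 = sum_k rho(S_i P_k)(1 (x) z_k^* ), hence all of O_n (x) C(T^n).
   If rho were a lift, then rho(S_1) would be of the form sum_j S_j (x) b_j, so
   that u = (S_1^* (x) 1) rho(S_1) = 1 (x) b_1 would commute with S_1 (x) 1.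
   But u (S_1 (x) 1) = S_1 (x) z_1, while (S_1 (x) 1) u = sum_k S_1 P_k (x) z_k;
   multiplying by P_2 S_1^* (x) 1 gives P_2 (x) z_1 = P_2 (x) z_2, so z_1 = z_2. *)
Require Import Defs.
From HB Require Import structures.
From mathcomp Require Import all_boot all_order all_algebra.
From mathcomp Require Import complex.
From mathcomp Require Import all_classical all_reals all_analysis.
Import Order.TTheory GRing.Theory Num.Theory.
Import numFieldNormedType.Exports.
Set Implicit Arguments.
Unset Strict Implicit.
Unset Printing Implicit Defensive.
Local Open Scope ring_scope.
Local Open Scope classical_set_scope.

(** * Linear maps and closed spans *)

Section LinearMaps.
Variable R : realType.
Local Notation K := R[i].

Lemma linear_mapD (V W : lmodType K) (f : V -> W) :
  linear_map f -> {morph f : x y / x + y}.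
Proof. by move=> fl x y; have := fl 1 x y; rewrite !scale1r. Qed.

Lemma linear_map0 (V W : lmodType K) (f : V -> W) : linear_map f -> f 0 = 0.
Proof.
by move=> fl; apply: (@addrI _ (f 0)); rewrite -linear_mapD // !addr0.
Qed.

Lemma linear_mapZ (V W : lmodType K) (f : V -> W) (c : K) x :
  linear_map f -> f (c *: x) = c *: f x.
Proof. by move=> fl; have := fl c x 0; rewrite !addr0 linear_map0 // addr0. Qed.

Lemma linear_mapB (V W : lmodType K) (f : V -> W) :
  linear_map f -> {morph f : x y / x - y}.
Proof.
move=> fl x y; rewrite linear_mapD // -scaleN1r linear_mapZ //.
by rewrite scaleN1r.
Qed.

Lemma linear_map_sum (V W : lmodType K) (f : V -> W) I (r : seq I)
    (P : pred I) (F : I -> V) :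
  linear_map f -> f (\sum_(i <- r | P i) F i) = \sum_(i <- r | P i) f (F i).
Proof.
move=> fl; apply: (big_morph f); first exact: linear_mapD.
exact: linear_map0.
Qed.

Lemma linear_map_comp (U V W : lmodType K) (f : V -> W) (g : U -> V) :
  linear_map f -> linear_map g -> linear_map (f \o g).
Proof. by move=> fl gl c x y /=; rewrite gl fl. Qed.

Lemma linear_map_continuous (V W : normedModType K) (f : V -> W) (M : K) :
  linear_map f -> (forall x, `|f x| <= M * `|x|) -> continuous f.
Proof.
move=> fl fM x; apply/cvgrPdist_lt => e e0.
(* [M] is only a complex number, so [|M|] replaces it; adding 1 keeps the divisor of [e] positive
   even when [M] is 0. *)
have N0 : 0 < `|M| + 1 by rewrite ltr_wpDl.
near=> y.
have xy : `|x - y| < e / (`|M| + 1).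
  by near: y; apply: cvgr_dist_lt; rewrite ?divr_gt0.
rewrite -linear_mapB //; apply: le_lt_trans (fM _) _.
have MM : M * `|x - y| <= `|M| * `|x - y|.
  have : 0 <= M * `|x - y| by apply: le_trans (fM _).
  by move=> /ger0_norm <-; rewrite normrM normr_id.
apply: le_lt_trans MM _.
apply: (@le_lt_trans _ _ ((`|M| + 1) * `|x - y|)).
  by rewrite ler_wpM2r // lerDl.
by rewrite mulrC -ltr_pdivlMr.
Unshelve. all: by end_near. Qed.

Lemma continuous_comp_all (T U V : topologicalType) (f : U -> V) (g : T -> U) :
  continuous f -> continuous g -> continuous (f \o g).
Proof. by move=> fc gc x; apply: continuous_comp; [exact: gc|exact: fc]. Qed.

Lemma lspan_mem (V : lmodType K) (S : set V) x : S x -> lspan S x.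
Proof.
move=> Sx; exists 1%N, (fun=> 1), (fun=> x); split => //.
by rewrite big_ord_recl big_ord0 scale1r addr0.
Qed.

Lemma lspan_comb (V : lmodType K) (S : set V) (c : K) x y :
  lspan S x -> lspan S y -> lspan S (c *: x + y).
Proof.
move=> [m [a [s [Ss ->]]]] [k [b [r [Sr ->]]]].
exists (m + k)%N, (fun i : 'I_(m + k) => match fintype.split i with inl j => c * a j | inr j => b j end),
  (fun i : 'I_(m + k) => match fintype.split i with inl j => s j | inr j => r j end); split.
  by move=> i; case: fintype.split.
rewrite big_split_ord scaler_sumr /=; congr (_ + _); apply: eq_bigr => i _.
  by rewrite (unsplitK (inl i : 'I_m + 'I_k)%type) scalerA.
by rewrite (unsplitK (inr i : 'I_m + 'I_k)%type).
Qed.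

Lemma cspan_mem (V : normedModType K) (S : set V) x : S x -> cspan S x.
Proof. by move=> Sx; apply: subset_closure; exact: lspan_mem. Qed.

Lemma closed_cspan (V : normedModType K) (S : set V) : closed (cspan S).
Proof. exact: closed_closure. Qed.
Arguments closed_cspan {V} S.

(** Induction principle for closed spans: stability under binary combinations gives all finite ones,
    and closure is monotone. [D 0] covers the empty combination. *)
Lemma cspan_min (V : normedModType K) (S D : set V) :
  closed D -> D 0 -> (forall (c : K) x y, D x -> D y -> D (c *: x + y)) ->
  S `<=` D -> cspan S `<=` D.
Proof.
move=> Dc D0 Dl SD; rewrite closure_id in Dc; rewrite Dc; apply: closure_subset.
move=> _ [m [c [s [Ss ->]]]]; elim/big_ind: _ => [//|x y Dx Dy|i _].
  by rewrite -[x]scale1r; exact: Dl.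
by rewrite -[_ *: _]addr0; apply: Dl => //; exact: SD.
Qed.

Lemma closed_eq_fun (V W : normedModType K) (f g : V -> W) :
  continuous f -> continuous g -> closed [set x | f x = g x].
Proof.
move=> fc gc; have -> : [set x | f x = g x] = (f \- g) @^-1` [set 0].
  apply/seteqP; split => x /=; first by move=> ->; rewrite subrr.
  by move/eqP; rewrite subr_eq0 => /eqP.
apply: closed_comp.
  by move=> x _; apply: cvgB; [exact: fc|exact: gc].
apply: accessible_closed_set1; apply: hausdorff_accessible; exact: norm_hausdorff.
Qed.

(** The set where two continuous linear maps agree is a closed subspace. Identities on tensor
    products are reduced to elementary tensors in this way. *)
Lemma cspan_eq (V W : normedModType K) (S : set V) (f g : V -> W) :
  cspan S = setT -> linear_map f -> linear_map g ->
  continuous f -> continuous g -> (forall x, S x -> f x = g x) -> f =1 g.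
Proof.
move=> ST fl gl fc gc fg x.
have : cspan S x by rewrite ST.
apply: (@cspan_min V S [set x | f x = g x]) => //.
- exact: closed_eq_fun.
- by rewrite /= !linear_map0.
- by move=> c y z /= fy fz; rewrite fl gl fy fz.
Qed.

Lemma closed_mem_comp (V W : normedModType K) (f : V -> W) (D : set W) :
  continuous f -> closed D -> closed [set x | D (f x)].
Proof. by move=> fc; apply: closed_comp => x _; exact: fc. Qed.

Lemma cspan_linear (V : normedModType K) (S : set V) (c : K) x y :
  cspan S x -> cspan S y -> cspan S (c *: x + y).
Proof.
have contl (a : K) (z : V) : continuous (fun u : V => a *: u + z).
  move=> u; apply: cvgD; last exact: cvg_cst.
  by apply: cvgZr; exact: cvg_id.
have contr (z : V) : continuous (fun u => z + u).
  by move=> u; apply: cvgD; [exact: cvg_cst|exact: cvg_id].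
(* Closures are taken one variable at a time: here the second variable is still an algebraic
   combination. *)
have half u v (a : K) : cspan S u -> lspan S v -> cspan S (a *: u + v).
  move=> Su Sv; move: u Su.
  suff : closure (lspan S) `<=` [set u | cspan S (a *: u + v)] by [].
  have /closure_id -> : closed [set u | cspan S (a *: u + v)].
    by apply: (@closed_mem_comp _ _ (fun u => a *: u + v)) => //; exact: closed_cspan.
  by apply: closure_subset => u Su; apply: subset_closure; exact: lspan_comb.
move=> Sx; move: y.
suff : closure (lspan S) `<=` [set y | cspan S (c *: x + y)] by [].
have /closure_id -> : closed [set y | cspan S (c *: x + y)].
  by apply: (@closed_mem_comp _ _ (fun u => c *: x + u)) => //; exact: closed_cspan.
by apply: closure_subset => u Su; exact: half.
Qed.

(* [G] is the graph of a contraction on a dense subspace. *)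
Lemma contractive_extension (V : normedModType K) (W : completeNormedModType K)
    (G : V -> W -> Prop) :
  (forall (c : K) v w v' w', G v w -> G v' w' ->
     G (c *: v + v') (c *: w + w')) ->
  (forall v w, G v w -> `|w| <= `|v|) ->
  closure [set v | exists w, G v w] = setT ->
  exists F : V -> W, [/\ linear_map F, continuous F & forall v w, G v w -> F v = w].
Proof.
move=> Gl Gn Gd; pose dom := [set v | exists w, G v w].
have GB v w v' w' : G v w -> G v' w' -> G (v - v') (w - w').
  by move=> h h'; have := Gl (-1) _ _ _ _ h' h; rewrite !scaleN1r ![- _ + _]addrC.
(* [P] is the closure of [G] in the product of [V] and [W]; it will be the graph of the
   extension. *)
pose P v w := forall e : K, 0 < e -> exists v' w',
  [/\ G v' w', `|v - v'| < e & `|w - w'| < e].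
have GP v w : G v w -> P v w.
  by move=> h e e0; exists v, w; rewrite !subrr !normr0.
have Ptot v : exists w, P v w.
  pose g v := xget 0 [set w | G v w].
  have gP u : dom u -> G u (g u) by move=> /(xgetPex 0).
  (* [v] is approached from inside the domain; density makes this filter proper. *)
  have PF : ProperFilter (within dom (nbhs v)).
    apply: Build_ProperFilter_ex.
    move=> A /= vA; have : closure dom v by rewrite Gd.
    move=> /(_ _ vA) [u [du Au]]; exists u; exact: Au.
  have : cvg (g @ within dom (nbhs v)).
    (* Contractivity applied to differences makes the image filter Cauchy, so completeness of [W]
       supplies a value at [v]. *)
    apply: cauchy_cvg; apply/cauchyP => e e0.
    have e2 : 0 < e / 2%:R by rewrite divr_gt0.
    have : closure dom v by rewrite Gd.
    move=> /(_ _ (nbhsx_ballx v _ e2)) [u [du]].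
    rewrite -ball_normE /ball_ /= => vu.
    exists (g u); suff : within dom (nbhs v) (g @^-1` ball (g u) e) by [].
    apply: filterS (nbhsx_ballx v _ e2) => x.
    rewrite /preimage /= -!ball_normE /ball_ /= => vx dx.
    apply: le_lt_trans (Gn _ _ (GB _ _ _ _ (gP _ du) (gP _ dx))) _.
    rewrite -(subrKA v) (le_lt_trans (ler_normD _ _)) // [e]splitr ltrD //.
    by rewrite distrC.
  move=> /cvg_ex[w /cvgrPdist_lt gw]; exists w => e e0.
  have [u [du [vu wu]]] : exists u, dom u /\ `|v - u| < e /\ `|w - g u| < e.
    apply: (@filter_ex _ _ PF); apply: filterI; first by apply: nearW.
    apply: filterI; last exact: gw.
    by apply: filterS (nbhsx_ballx v _ e0) => x; rewrite -ball_normE.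
  by exists u, (g u); split => //; exact: gP.
have Pl (c : K) v w v' w' : P v w -> P v' w' -> P (c *: v + v') (c *: w + w').
  move=> h h' e e0.
  have c1 : 0 < `|c| + 1 by rewrite ltr_wpDl.
  have e2 : 0 < e / 2%:R by rewrite divr_gt0.
  have e3 : 0 < e / 2%:R / (`|c| + 1) by rewrite divr_gt0.
  have [u [x [Gu vu wx]]] := h _ e3.
  have [u' [x' [Gu' vu' wx']]] := h' _ e2.
  have key (U : normedModType K) (a b a' b' : U) : `|a - b| < e / 2%:R / (`|c| + 1) ->
      `|a' - b'| < e / 2%:R -> `|c *: a + a' - (c *: b + b')| < e.
    move=> ab ab'; rewrite opprD addrACA -scalerBr [e]splitr.
    rewrite (le_lt_trans (ler_normD _ _)) // ler_ltD // normrZ.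
    apply: (@le_trans _ _ ((`|c| + 1) * `|a - b|)).
      by rewrite ler_wpM2r // lerDl.
    by rewrite mulrC -ler_pdivlMr // ltW.
  by exists (c *: u + u'), (c *: x + x'); split; [exact: Gl|exact: key|exact: key].
have Pn v w : P v w -> `|w| <= `|v|.
  move=> h; apply/ler_addgt0Pr => e e0.
  have e2 : 0 < e / 2%:R by rewrite divr_gt0.
  have [u [x [Gu vu wx]]] := h _ e2.
  rewrite -(subrK x w) (le_trans (ler_normD _ _)) //.
  rewrite [e]splitr addrCA lerD // ?(ltW wx) //.
  apply: le_trans (Gn _ _ Gu) _.
  by rewrite -{1}(subrK v u) addrC (le_trans (ler_normD _ _)) // lerD // distrC ltW.
(* Two values at [v] differ by a value at 0, which [Pn] forces to vanish. *)
have Pf v w w' : P v w -> P v w' -> w = w'.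
  move=> h h'; apply/eqP; rewrite -subr_eq0 -normr_le0.
  have := Pl (-1) _ _ _ _ h' h; rewrite !scaleN1r addNr => /Pn.
  by rewrite normr0 addrC.
pose F v := xget 0 [set w | P v w].
have FP v : P v (F v) by exact: (xgetPex 0 (Ptot v)).
have Fl : linear_map F.
  by move=> c x y; apply: Pf (FP _) _; exact: Pl.
exists F; split => //.
  by apply: (linear_map_continuous (M := 1)) => // x; rewrite mul1r; exact: Pn.
by move=> v w Gvw; apply: Pf (FP _) _; exact: GP.
Unshelve. all: by end_near. Qed.

(** Once one map qualifies, the choice made by [xget] satisfies the defining conditions instead of
    falling back on the default value. *)
Lemma tensor_extP (A B : Type) (V W : normedModType K) (p : A -> B -> V)
    (h : A -> B -> W) (F : V -> W) :
  linear_map F -> continuous F -> (forall a b, F (p a b) = h a b) ->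
  [/\ linear_map (tensor_ext p h), continuous (tensor_ext p h)
    & forall a b, tensor_ext p h (p a b) = h a b].
Proof.
move=> Fl Fc Fp; rewrite /tensor_ext; case: xgetP => [G -> //|/(_ F)].
by case.
Qed.

End LinearMaps.

(** * C*-algebras and tensor products of homomorphisms *)

Section CstarAlgebras.
Variable R : realType.
Local Notation K := R[i].

Section Star.
Variable A : cstarAlg R.
Implicit Types x y : A.

Lemma starK : involutive (@star R A). Proof. exact: cstar_starK. Qed.

Lemma starD x y : star (x + y) = star x + star y.
Proof. exact: cstar_starD. Qed.

Lemma starM x y : star (x * y) = star y * star x.
Proof. exact: cstar_starM. Qed.

Lemma starZ (c : K) x : star (c *: x) = c^* *: star x.
Proof. exact: cstar_starZ. Qed.

Lemma star0 : star (0 : A) = 0.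
Proof. by have := starZ 0 (0 : A); rewrite conjC0 !scale0r. Qed.

Lemma star1 : star (1 : A) = 1.
Proof. by rewrite -[LHS]mulr1 -{2}(starK 1) -starM mulr1 starK. Qed.

Lemma star_sum I (r : seq I) (P : pred I) (F : I -> A) :
  star (\sum_(i <- r | P i) F i) = \sum_(i <- r | P i) star (F i).
Proof. by apply: (big_morph (@star R A)); [exact: starD|exact: star0]. Qed.

Lemma cstar_norm_mul_le x y : `|x * y| <= `|x| * `|y|.
Proof. exact: cstar_normM. Qed.

(** The C*-identity and submultiplicativity bound the square of [|y|] by [|star y| * |y|]; cancel
    [|y|], then take [y] to be [x] and [star x]. *)
Lemma norm_star x : `|star x| = `|x|.
Proof.
have le y : `|y| <= `|star y|.
  have [->|y0] := eqVneq y 0; first by rewrite normr0.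
  have ny : 0 < `|y| by rewrite normr_gt0.
  rewrite -(ler_pM2r ny) -expr2 -(cstar_normE y); exact: cstar_normM.
by apply/eqP; rewrite eq_le -{2}[x]starK !le.
Qed.

Lemma linear_mull y : linear_map (fun x : A => x * y).
Proof. by move=> c u v; rewrite mulrDl scalerAl. Qed.

Lemma linear_mulr y : linear_map (fun x : A => y * x).
Proof. by move=> c u v; rewrite mulrDr scalerAr. Qed.

Lemma continuous_mull y : continuous (fun x : A => x * y).
Proof.
apply: (linear_map_continuous (M := `|y|)); first exact: linear_mull.
by move=> x; rewrite mulrC; exact: cstar_norm_mul_le.
Qed.

Lemma continuous_mulr y : continuous (fun x : A => y * x).
Proof.
apply: (linear_map_continuous (M := `|y|)); first exact: linear_mulr.
by move=> x; exact: cstar_norm_mul_le.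
Qed.

Lemma continuous_star : continuous (@star R A).
Proof.
move=> x; apply/cvgrPdist_lt => e e0; near=> y.
have -> : star x - star y = star (x - y).
  by rewrite starD -scaleN1r -[- y]scaleN1r starZ conjCN1.
by rewrite norm_star; near: y; exact: cvgr_dist_lt.
Unshelve. all: by end_near. Qed.

End Star.

Lemma unital_star_hom_comp (A B D : cstarAlg R) (f : B -> D) (g : A -> B) :
  unital_star_hom f -> unital_star_hom g -> unital_star_hom (f \o g).
Proof.
move=> [fl f1 fM fs] [gl g1 gM gs]; split => [||x y|x] /=.
- exact: linear_map_comp.
- by rewrite g1.
- by rewrite gM.
- by rewrite gs.
Qed.

Lemma representation_comp (A B D : cstarAlg R) (E : hilbertModule D)
    (f : A -> B) (pi : B -> E -> E) :
  unital_star_hom f -> is_representation pi -> is_representation (pi \o f).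
Proof.
move=> [fl f1 fM fs] [p1 p2 p3 p4]; split => /=.
- by move=> a x y; rewrite fs.
- by move=> c a b x; rewrite fl p2.
- by move=> x; rewrite f1.
- by move=> a b x; rewrite fM.
Qed.

End CstarAlgebras.

(** * Tensor products of unital *-homomorphisms for the minimal norm *)

Section TensorMap.
Variables (R : realType) (t : tensorProduct R).
Local Notation K := R[i].

Lemma tpure_dense (A B : cstarAlg R) :
  cspan [set x | exists a b, x = tpure t a b] = [set: tens t A B].
Proof. exact: (min_tensor_dense (tpureP t A B)). Qed.

Lemma tpureM (A B : cstarAlg R) (a a' : A) (b b' : B) :
  tpure t (a * a') (b * b') = tpure t a b * tpure t a' b'.
Proof. exact: (min_tensorM (tpureP t A B)). Qed.

Lemma tpure_star (A B : cstarAlg R) (a : A) (b : B) :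
  tpure t (star a) (star b) = star (tpure t a b).
Proof. exact: (min_tensor_star (tpureP t A B)). Qed.

Lemma tpure11 (A B : cstarAlg R) : tpure t (1 : A) (1 : B) = 1.
Proof. exact: (min_tensor1 (tpureP t A B)). Qed.

Lemma tpure_linl (A B : cstarAlg R) (b : B) :
  linear_map (fun a : A => tpure t a b).
Proof. exact: (min_tensor_linl (tpureP t A B)). Qed.

Lemma tpure_linr (A B : cstarAlg R) (a : A) : linear_map (@tpure R t A B a).
Proof. exact: (min_tensor_linr (tpureP t A B)). Qed.

(** A nonzero vector is a linearly independent family of length one, so this is the case [m = 1] of
    [min_tensor_inj]. *)
Lemma tpure_inj (A B : cstarAlg R) (a : A) (b : B) :
  a != 0 -> tpure t a b = 0 -> b = 0.
Proof.
move=> a0 ab0.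
have := @min_tensor_inj _ _ _ _ _ (tpureP t A B) 1 (fun=> a) (fun=> b).
rewrite !big_ord_recl !big_ord0 addr0 => H.
apply: (H _ ab0 ord0) => c.
rewrite big_ord_recl big_ord0 addr0 => /eqP.
by rewrite scaler_eq0 (negPf a0) orbF => /eqP c0 i; rewrite ord1.
Qed.

Section Map.
Variables (A A' B B' : cstarAlg R) (f : A -> A') (g : B -> B').
Hypotheses (fh : unital_star_hom f) (gh : unital_star_hom g).

(** Representations of [A'] and [B'] pull back along [f] and [g] to representations of [A] and [B],
    so every operator norm counted on the left is also counted on the right. *)
Lemma tmap_norm_le (s : seq (A * B)) :
  `|\sum_(a <- s) tpure t (f a.1) (g a.2)| <= `|\sum_(a <- s) tpure t a.1 a.2|.
Proof.
have := @min_tensor_norm_lub _ _ _ _ _ (tpureP t A' B')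
  [seq (f a.1, g a.2) | a <- s] `|\sum_(a <- s) tpure t a.1 a.2|.
rewrite big_map /=; apply => // H1 H2 pi sigma pr sr v.
have := @min_tensor_norm_ub _ _ _ _ _ (tpureP t A B) s H1 H2 _ _
  (representation_comp fh pr) (representation_comp gh sr) v.
by rewrite allpairs_mapl.
Qed.

Lemma tmapP : [/\ linear_map (tmap f g : tens t A B -> _),
  continuous (tmap f g : tens t A B -> tens t A' B') &
  forall a b, tmap f g (tpure t a b) = tpure t (f a) (g b)].
Proof.
have [fl _ _ _] := fh; have [gl _ _ _] := gh.
(* A relation, because an element has many expressions as a sum of elementary tensors; the norm
   estimate makes it single-valued. *)
pose G (v : tens t A B) (w : tens t A' B') := exists s : seq (A * B),
  v = \sum_(a <- s) tpure t a.1 a.2 /\ w = \sum_(a <- s) tpure t (f a.1) (g a.2).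
have Gl (c : K) v w v' w' : G v w -> G v' w' -> G (c *: v + v') (c *: w + w').
  move=> [s [-> ->]] [s' [-> ->]].
  exists ([seq (c *: a.1, a.2) | a <- s] ++ s').
  rewrite !big_cat !big_map !scaler_sumr /=; split; congr (_ + _).
    by apply: eq_bigr => a _; rewrite (linear_mapZ _ _ (tpure_linl _)).
  apply: eq_bigr => a _.
  by rewrite (linear_mapZ _ _ fl) (linear_mapZ _ _ (tpure_linl _)).
have [||| F [Fl Fc Fp]] := @contractive_extension R (tens t A B) (tens t A' B') G.
- exact: Gl.
- by move=> v w [s [-> ->]]; exact: tmap_norm_le.
- rewrite -subTset -(tpure_dense A B); apply: closure_subset.
  move=> _ [m [c [s [Ss ->]]]]; elim/big_ind: _.
  + by exists 0, [::]; rewrite !big_nil.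
  + move=> x y [w xw] [w' yw']; exists (1 *: w + w').
    by rewrite -[x]scale1r; exact: Gl.
  + move=> i _; have [a [b ->]] := Ss i; exists (c i *: tpure t (f a) (g b)).
    rewrite -[_ *: _]addr0 -[X in G _ X]addr0; apply: Gl.
      by exists [:: (a, b)]; rewrite !big_seq1.
    by exists [::]; rewrite !big_nil.
- apply: (tensor_extP Fl Fc) => a b; apply: Fp.
  by exists [:: (a, b)]; rewrite !big_seq1.
Qed.

Lemma tmapE a b : tmap f g (tpure t a b) = tpure t (f a) (g b).
Proof. by have [_ _] := tmapP. Qed.

Lemma tmap_hom : unital_star_hom (tmap f g : tens t A B -> tens t A' B').
Proof.
have [fl f1 fM fs] := fh; have [gl g1 gM gs] := gh.
have [tl tc tE] := tmapP; split => //.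
- by rewrite -tpure11 tE f1 g1 tpure11.
- move=> x y; move: y; apply: (cspan_eq (tpure_dense A B)).
  + exact: linear_map_comp tl (linear_mulr x).
  + exact: linear_map_comp (linear_mulr _) tl.
  + exact: continuous_comp_all tc (@continuous_mulr _ _ _).
  + exact: continuous_comp_all (@continuous_mulr _ _ _) tc.
  move=> _ [a' [b' ->]]; move: x; apply: (cspan_eq (tpure_dense A B)).
  + exact: linear_map_comp tl (linear_mull _).
  + exact: linear_map_comp (linear_mull _) tl.
  + exact: continuous_comp_all tc (@continuous_mull _ _ _).
  + exact: continuous_comp_all (@continuous_mull _ _ _) tc.
  by move=> _ [a [b ->]]; rewrite -tpureM !tE fM gM tpureM.
(* [star] is conjugate-linear; after one more [star] on both sides, the two sides become linear in
   [x] and [cspan_eq] applies. *)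
- move=> x; rewrite -[LHS]starK; congr star; move: x.
  apply: (cspan_eq (tpure_dense A B)) => //.
  + by move=> c x y; rewrite starD starZ tl starD starZ conjCK.
  + apply: continuous_comp_all (@continuous_star _ _) _.
    exact: continuous_comp_all tc (@continuous_star _ _).
  by move=> _ [a [b ->]]; rewrite -tpure_star !tE -tpure_star fs gs !starK.
Qed.

End Map.
End TensorMap.

(** * Closed *-subalgebras and the universal property *)

Record closed_star_subalgebra (R : realType) (A : cstarAlg R) (X : set A) :
    Prop := {
  subalg_closed : closed X;
  subalg1 : X 1;
  subalg_linear : forall (c : R[i]) x y, X x -> X y -> X (c *: x + y);
  subalgM : forall x y, X x -> X y -> X (x * y);
  subalg_star : forall x, X x -> X (star x)
}.

(** The proof [hX] is an argument so that the structures built from it can be inferred from the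
    predicate and from the subtype. *)
Definition subalg_pred (R : realType) (A : cstarAlg R) (X : set A)
  (hX : closed_star_subalgebra X) : {pred A} := [pred x | `[< X x >]].

Definition subalg_car (R : realType) (A : cstarAlg R) (X : set A)
  (hX : closed_star_subalgebra X) : Type := {x : A | x \in subalg_pred hX}.

Section SubCstarAlgebra.
Variables (R : realType) (A : cstarAlg R) (X : set A).
Hypothesis hX : closed_star_subalgebra X.
Local Notation K := R[i].
Local Notation SX := (subalg_car hX).

Definition subalg_elt x (Xx : X x) : SX :=
  exist (fun x => x \in subalg_pred hX) x (asboolT Xx).

Lemma subalg_valP (x : SX) : X (val x).
Proof. by case: x => x /= /asboolP. Qed.

Lemma subalg0 : X 0.
Proof.
have := subalg_linear hX (-1) (subalg1 hX) (subalg1 hX).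
by rewrite scaleN1r addNr.
Qed.

Lemma subalg_submod : submod_closed (subalg_pred hX).
Proof.
split => [|c x y /asboolP Xx /asboolP Xy]; apply/asboolP; first exact: subalg0.
exact: (subalg_linear hX).
Qed.

HB.instance Definition _ := GRing.isSubmodClosed.Build _ _ (subalg_pred hX)
  subalg_submod.
HB.instance Definition _ := SubChoice.on SX.
HB.instance Definition _ := [SubChoice_isSubLmodule of SX by <:].

Definition subalg_norm (x : SX) : K := `|val x|.

Lemma subalg_normD x y : subalg_norm (x + y) <= subalg_norm x + subalg_norm y.
Proof. exact: ler_normD. Qed.

Lemma subalg_normZ (c : K) x : subalg_norm (c *: x) = `|c| * subalg_norm x.
Proof. exact: normrZ. Qed.

Lemma subalg_norm0_eq0 x : subalg_norm x = 0 -> x = 0.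
Proof. by move=> /normr0_eq0 x0; apply: val_inj. Qed.

HB.instance Definition _ :=
  Lmodule_isNormed.Build K SX subalg_normD subalg_normZ subalg_norm0_eq0.

(** A Cauchy filter converges in the complete algebra [A], and closedness keeps its limit in [X]. *)
Lemma subalg_complete (F : set_system SX) : ProperFilter F -> cauchy F -> cvg F.
Proof.
move=> PF /cauchyP FC.
have : cvg ((val : SX -> A) @ F).
  apply: cauchy_cvg; apply/cauchyP => e e0; have [x Fx] := FC e e0.
  exists (val x); suff : F ((val : SX -> A) @^-1` ball (val x) e) by [].
  by apply: filterS Fx => y; rewrite /preimage /= -!ball_normE.
move=> /cvg_ex[l Fl]; have Xl : X l.
  apply: (closed_cvg _ (subalg_closed hX)) Fl.
  by apply: nearW => x; exact: subalg_valP.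
apply/cvg_ex; exists (subalg_elt Xl); apply/cvgrPdist_lt => e e0.
by move/cvgrPdist_lt : Fl => /(_ e e0).
Qed.

HB.instance Definition _ := Uniform_isComplete.Build SX subalg_complete.

Definition subalg_one : SX := subalg_elt (subalg1 hX).

Definition subalg_mul (x y : SX) : SX :=
  subalg_elt (subalgM hX (subalg_valP x) (subalg_valP y)).

Definition subalg_conj (x : SX) : SX :=
  subalg_elt (subalg_star hX (subalg_valP x)).

Definition subCstarAlg : cstarAlg R.
Proof.
refine (@CstarAlg R SX subalg_one subalg_mul subalg_conj
  _ _ _ _ _ _ _ _ _ _ _ _ _ _).
- by move=> x y z; apply: val_inj; exact: mulrA.
- by move=> x; apply: val_inj; exact: mul1r.
- by move=> x; apply: val_inj; exact: mulr1.
- by move=> x y z; apply: val_inj; exact: mulrDl.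
- by move=> x y z; apply: val_inj; exact: mulrDr.
- by move=> c x y; apply: val_inj; exact: scalerAl.
- by move=> c x y; apply: val_inj; exact: scalerAr.
- by apply/eqP => /(congr1 val) /eqP; exact/negP/oner_neq0.
- by move=> x; apply: val_inj; exact: starK.
- by move=> x y; apply: val_inj; exact: starD.
- by move=> c x; apply: val_inj; exact: starZ.
- by move=> x y; apply: val_inj; exact: starM.
- by move=> x y; exact: cstar_norm_mul_le.
- by move=> x; exact: cstar_normE.
Defined.

Definition subCstar_incl (x : subCstarAlg) : A := val (x : SX).

Lemma subCstar_incl_inj : injective subCstar_incl.
Proof. by move=> x y; exact: val_inj. Qed.

Lemma subCstar_incl_hom : unital_star_hom subCstar_incl.
Proof. by []. Qed.

End SubCstarAlgebra.

(** * Homomorphisms out of the Cuntz algebra *)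

Section Cuntz.
Variables (R : realType) (n : nat) (O : cstarAlg R) (S : 'I_n -> O).
Hypothesis hO : is_cuntz S.

Lemma cuntz_relations_hom (A : cstarAlg R) (f : O -> A) :
  unital_star_hom f -> cuntz_relations (f \o S).
Proof.
move=> [fl f1 fM fs]; have [Sd S1] := cuntz_rel hO; split => [i j|] /=.
  rewrite -fs -fM Sd; case: (i == j); first exact: f1.
  exact: linear_map0.
by under eq_bigr => i _ do rewrite -fs -fM; rewrite -linear_map_sum // S1.
Qed.

(** Both maps solve the universal problem for the Cuntz family formed by the images of the
    generators under [f]. *)
Lemma cuntz_hom_eq (A : cstarAlg R) (f g : O -> A) :
  unital_star_hom f -> unital_star_hom g -> (forall i, f (S i) = g (S i)) ->
  f = g.
Proof.
move=> fh gh fg.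
have [h [_ hu]] := cuntz_universal hO (cuntz_relations_hom fh).
rewrite -(hu f); last by split.
by apply: hu; split => // i; rewrite -fg.
Qed.

(* Universality replaces continuity of [f]: it yields a homomorphism into the
   C*-algebra [X], and its composite with the inclusion must be [f]. *)
Lemma cuntz_hom_subalgebra (A : cstarAlg R) (X : set A) (f : O -> A) :
  closed_star_subalgebra X -> unital_star_hom f -> (forall i, X (f (S i))) ->
  forall a, X (f a).
Proof.
move=> hX fh Xf; pose T i : subCstarAlg hX := subalg_elt hX (Xf i).
have [il i1 iM iS] := subCstar_incl_hom hX.
have [fd f1] := cuntz_relations_hom fh.
have Trel : cuntz_relations T.
  (* The inclusion is an injective homomorphism, so the relations may be checked in [A]. *)
  split => [i j|]; apply: (@subCstar_incl_inj _ _ _ hX).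
    rewrite iM iS; apply: etrans (fd i j) _.
    by case: (i == j); rewrite ?i1 ?linear_map0.
  rewrite linear_map_sum // i1 -f1; apply: eq_bigr => i _; by rewrite iM iS.
have [g [[gh gT] _]] := cuntz_universal hO Trel.
have <- : (@subCstar_incl _ _ _ hX) \o g = f.
  apply: cuntz_hom_eq => //; first exact: unital_star_hom_comp.
  by move=> i /=; rewrite gT.
by move=> a; exact: subalg_valP.
Qed.

End Cuntz.

(** * The torus action *)

Section TorusAlgebra.
Variables (R : realType) (n : nat).

Lemma torusAlg_mulC (b c : torusAlg R n) : b * c = c * b.
Proof. by apply: CfunP => x; exact: mulrC. Qed.

Lemma torus_coord_unitary (i : 'I_n) :
  torus_coord R i * star (torus_coord R i) = 1.
Proof.
apply: CfunP => x /=; rewrite -normCK.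
by have /set_mem -> := valP x; rewrite expr1n.
Qed.

Lemma torus_coord_inj : injective (@torus_coord R n).
Proof.
move=> i j ij; apply/eqP/negPn/negP => nij.
(* A point of the torus separating the two coordinates: equality of the functions there would give
   [1 = -1]. *)
pose v : 'rV[R[i]]_n := \row_k (if k == i then 1 else -1).
have vT : v \in @torus R n.
  by apply/mem_set => k; rewrite mxE; case: ifP => _; rewrite ?normrN normr1.
have := congr1 (fun f : torusAlg R n => val f (SigSub vT)) ij.
rewrite /= !mxE eqxx eq_sym (negPf nij) => /eqP.
by rewrite -subr_eq0 opprK -mulr2n pnatr_eq0.
Qed.

End TorusAlgebra.

Section TorusAction.
Variables (R : realType) (n : nat) (t : tensorProduct R).
Variables (O : cstarAlg R) (S : 'I_n -> O).
Hypothesis hO : is_cuntz S.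
Local Notation K := R[i].
Local Notation B := (torusAlg R n).
Local Notation T := (tens t O B).
Local Notation z := (@torus_coord R n).
Local Notation u := (cuntz_unitary t S).

Lemma tpure1_hom (A D : cstarAlg R) :
  unital_star_hom (fun a : A => tpure t a (1 : D)).
Proof.
split => [||x y|x]; [exact: tpure_linl|exact: tpure11| |].
  by rewrite -tpureM mulr1.
by rewrite -tpure_star star1.
Qed.

Lemma tpure_split (A D : cstarAlg R) (a : A) (d : D) :
  tpure t a d = tpure t a 1 * tpure t 1 d.
Proof. by rewrite -tpureM mulr1 mul1r. Qed.

(** On elementary tensors this is the commutativity of the function algebra of the torus; density
    does the rest. *)
Lemma tpure1_central (x : T) (b : B) : x * tpure t 1 b = tpure t 1 b * x.
Proof.
move: x; apply: (cspan_eq (tpure_dense t O B)).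
- exact: linear_mull.
- exact: linear_mulr.
- exact: continuous_mull.
- exact: continuous_mulr.
by move=> _ [a [c ->]]; rewrite -!tpureM mulr1 mul1r torusAlg_mulC.
Qed.

(** * The range projections [P k] and the unitary [u] *)

Local Notation P k := (S k * star (S k)).

Lemma cuntz_orth i j : star (S i) * S j = (i == j)%:R.
Proof. by case: (cuntz_rel hO) => + _; exact. Qed.

Lemma cuntz_projM i j : P i * P j = if i == j then P i else 0.
Proof.
rewrite mulrA -(mulrA (S i)) cuntz_orth; case: eqP => [->|_].
  by rewrite mulr1.
by rewrite mulr0 mul0r.
Qed.

Lemma cuntz_proj_star i : star (P i) = P i.
Proof. by rewrite starM starK. Qed.

(** Compressing [P i] by the isometry [S i] gives [star (S i) * P i * S i = 1]. *)
Lemma cuntz_proj_neq0 i : P i != 0.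
Proof.
apply/eqP => Pi0; have := oner_neq0 O; rewrite -[X in X != 0]mulr1.
have <- : star (S i) * S i = 1 by rewrite cuntz_orth eqxx.
by rewrite mulrA -(mulrA _ (S i)) Pi0 mulr0 mul0r eqxx.
Qed.

(** Orthogonality of the projections kills every summand of [u] but the one of index [k]: [u] is
    block diagonal with blocks [z k]. *)
Lemma cuntz_unitary_proj k : u * tpure t (P k) 1 = tpure t (P k) (z k).
Proof.
rewrite /cuntz_unitary mulr_suml (bigD1 k) //= big1 => [|j jk].
  by rewrite addr0 -tpureM mulr1 cuntz_projM eqxx.
rewrite -tpureM cuntz_projM (negPf jk).
exact: (linear_map0 (tpure_linl _ _)).
Qed.

Lemma cuntz_proj_unitary k : tpure t (P k) 1 * u = tpure t (P k) (z k).
Proof.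
rewrite /cuntz_unitary mulr_sumr (bigD1 k) //= big1 => [|j jk].
  by rewrite addr0 -tpureM mul1r cuntz_projM eqxx.
rewrite -tpureM cuntz_projM eq_sym (negPf jk).
exact: (linear_map0 (tpure_linl _ _)).
Qed.

Lemma cuntz_unitaryV : u * star u = 1.
Proof.
have [_ S1] := cuntz_rel hO.
rewrite -(tpure11 t) -S1 (linear_map_sum _ _ _ (tpure_linl _ _)) {2}/cuntz_unitary.
rewrite star_sum mulr_sumr; apply: eq_bigr => k _.
rewrite -tpure_star cuntz_proj_star tpure_split mulrA cuntz_unitary_proj.
by rewrite -tpureM mulr1 torus_coord_unitary.
Qed.

Lemma cuntz_unitaryVl : star u * u = 1.
Proof.
have [_ S1] := cuntz_rel hO.
rewrite -(tpure11 t) -S1 (linear_map_sum _ _ _ (tpure_linl _ _)) {2}/cuntz_unitary.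
rewrite mulr_sumr; apply: eq_bigr => k _.
have Pk : tpure t (P k) 1 = star (tpure t (P k) (1 : B)).
  by rewrite -tpure_star star1 cuntz_proj_star.
rewrite tpure_split mulrA Pk -starM cuntz_proj_unitary -tpure_star -tpureM mulr1.
by rewrite cuntz_proj_star torusAlg_mulC torus_coord_unitary.
Qed.

(** Right multiplication by a unitary preserves Cuntz families: [star u * u] remains in the
    orthogonality relations, and [u * star u] cancels inside each range projection. *)
Lemma torus_action_relations :
  cuntz_relations (fun i => tpure t (S i) 1 * u : T).
Proof.
have [_ S1] := cuntz_rel hO; split => [i j|].
  rewrite starM -tpure_star star1 mulrA -(mulrA (star u)) -tpureM mulr1.
  rewrite cuntz_orth; case: (i == j); first by rewrite tpure11 mulr1 cuntz_unitaryVl.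
  by rewrite (linear_map0 (tpure_linl _ _)) mulr0 mul0r.
rewrite -(tpure11 t) -S1 (linear_map_sum _ _ _ (tpure_linl _ _)).
apply: eq_bigr => i _; rewrite starM mulrA -(mulrA (tpure t (S i) 1)).
by rewrite cuntz_unitaryV mulr1 -tpure_star star1 -tpureM mulr1.
Qed.

(** * The action [rho]: coassociativity, density and the obstruction to a lift *)

Variable rho : O -> T.
Hypothesis rhoh : unital_star_hom rho.
Hypothesis rhoS : forall i, rho (S i) = tpure t (S i) 1 * u.

(** Since [u * star u = 1], [rho] sends [P k] to [P k] tensored with 1, and [u] multiplies that
    block by [z k]. Thus [S i * P k] is an eigenvector of the action with character [z k]. *)
Lemma torus_action_proj i k : rho (S i * P k) = tpure t (S i * P k) (z k).
Proof.
have [rl r1 rM rs] := rhoh.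
rewrite rM (_ : rho (P k) = tpure t (P k) 1).
  by rewrite rhoS -mulrA cuntz_unitary_proj -tpureM mul1r.
rewrite rM rs rhoS starM mulrA -(mulrA (tpure t (S k) 1)).
by rewrite cuntz_unitaryV mulr1 -tpure_star star1 -tpureM mulr1.
Qed.

(** Decomposes a generator into the eigenvectors of [torus_action_proj]. *)
Lemma cuntz_gen_sum i : S i = \sum_k S i * P k.
Proof. by have [_ S1] := cuntz_rel hO; rewrite -mulr_sumr S1 mulr1. Qed.

Lemma torus_action_coassoc (Delta : B -> tens t B B) a :
  unital_star_hom Delta -> (forall i, Delta (z i) = tpure t (z i) (z i)) ->
  tmap rho idfun (rho a) = tassoc (tmap idfun Delta (rho a)).
Proof.
move=> Dh Dz; have idh (A : cstarAlg R) : unital_star_hom (@idfun A) by [].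
have lh := unital_star_hom_comp (tmap_hom t rhoh (idh _)) rhoh.
have rh := unital_star_hom_comp (tassoc_hom t O B B)
  (unital_star_hom_comp (tmap_hom t (idh _) Dh) rhoh).
suff /(congr1 (fun f => f a)) :
  tmap rho idfun \o rho = tassoc (D := B) \o (tmap idfun Delta \o rho) by [].
apply: (cuntz_hom_eq hO lh rh) => i.
have [ll _ _ _] := lh; have [rl _ _ _] := rh.
rewrite cuntz_gen_sum !linear_map_sum //; apply: eq_bigr => k _ /=.
by rewrite torus_action_proj !tmapE // torus_action_proj Dz tassocE.
Qed.

Lemma torus_action_dense :
  cspan [set x | exists a b, x = rho a * tpure t 1 b] = [set: T].
Proof.
have [rl r1 rM rs] := rhoh.
set G := [set x | _].
have GX x : G x -> cspan G x by exact: cspan_mem.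
have X0 : cspan G 0.
  by apply: GX; exists 0, 0; rewrite linear_map0 // mul0r.
(* The factor [x] is reduced to an element of [G] first, then [y]. *)
have XM x y : cspan G x -> cspan G y -> cspan G (x * y).
  move=> + Xy; move: x; apply: cspan_min.
  - apply: (@closed_mem_comp _ _ _ (fun x : T => x * y)); last exact: closed_cspan.
    exact: continuous_mull.
  - by rewrite /= mul0r.
  - by move=> c x x' /= h h'; rewrite mulrDl -scalerAl; exact: cspan_linear.
  move=> _ [a [b ->]] /=; move: y Xy; apply: cspan_min.
  - apply: (@closed_mem_comp _ _ _ (fun y : T => rho a * tpure t 1 b * y)).
      exact: continuous_mulr.
    exact: closed_cspan.
  - by rewrite /= mulr0.
  - by move=> c x x' /= h h'; rewrite mulrDr -scalerAr; exact: cspan_linear.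
  (* Centrality moves [tpure t 1 b] past [rho a'], so the product is again of the form defining
     [G]. *)
  move=> _ [a' [b' ->]] /=; apply: GX; exists (a * a'), (b * b').
  rewrite -mulrA (mulrA (tpure t 1 b)) -tpure1_central rM -!mulrA -tpureM.
  by rewrite mulr1.
have Xalg : closed_star_subalgebra (cspan G).
  split => //.
  - exact: closed_cspan.
  - by apply: GX; exists 1, 1; rewrite r1 tpure11 mulr1.
  - by move=> c x y; exact: cspan_linear.
  apply: cspan_min.
  - apply: (@closed_mem_comp _ _ _ (@star R T)); last exact: closed_cspan.
    exact: continuous_star.
  - by rewrite /= star0.
  - by move=> c x y /= h h'; rewrite starD starZ; exact: cspan_linear.
  move=> _ [a [b ->]]; apply: GX; exists (star a), (star b).
  by rewrite starM rs tpure1_central -tpure_star star1.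
have XO (a : O) : cspan G (tpure t a 1).
  apply: (cuntz_hom_subalgebra hO Xalg (tpure1_hom O B)) => i.
  rewrite cuntz_gen_sum (linear_map_sum _ _ _ (tpure_linl _ _)).
  elim/big_ind : _ => // [x y Xx Xy|k _].
    by rewrite -[x]scale1r; exact: cspan_linear.
  (* The factor [star (z k)] cancels the character [z k] produced by [rho]. *)
  apply: GX; exists (S i * P k), (star (z k)).
  by rewrite torus_action_proj -tpureM mulr1 torus_coord_unitary.
rewrite -subTset -(tpure_dense t O B); apply: cspan_min => //.
- exact: closed_cspan.
- by move=> c x y; exact: cspan_linear.
move=> _ [a [b ->]]; rewrite tpure_split; apply: XM => //.
by apply: GX; exists 1, b; rewrite r1 mul1r.
Qed.

Lemma torus_action_not_lift (Delta : B -> tens t B B) (kA : complexAlg R -> O) :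
  (1 < n)%N -> ~ is_lift Delta (@cuntz_phi R n) (cuntz_kE S) kA rho.
Proof.
move=> n1 [alpha [lambda [_ _ _ rhoE _]]].
have [rl r1 rM rs] := rhoh.
(* Indices start at 0: [i0] and [i1] are the first two generators, distinct and available since [n]
   is at least 2. *)
pose i0 := Ordinal (ltnW n1); pose i1 := Ordinal n1.
have kEe i : cuntz_kE S (delta_mx 0 i : 'rV[K]_n) = S i.
  rewrite /cuntz_kE (bigD1 i) //= big1 => [|j ji].
    by rewrite addr0 mxE !eqxx scale1r.
  by rewrite mxE (negPf ji) scale0r.
(* The key point: [star (S i)] turns every vector of the correspondence into a scalar, so on
   elementary tensors [h] followed by this compression lands in the copy of [B], which commutes with
   [S i0] tensored with 1. *)
have skE i x : star (S i) * cuntz_kE S x = ((x : 'rV[K]_n) 0 i) *: 1.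
  rewrite /cuntz_kE mulr_sumr (bigD1 i) //= big1 => [|j ji].
    by rewrite addr0 -scalerAr cuntz_orth eqxx.
  by rewrite -scalerAr cuntz_orth eq_sym (negPf ji) scaler0.
pose h : htens t (euclid_hilb R n) B -> T := hmap_alg (cuntz_kE S) (@idfun B).
(* If no map qualifies, [tensor_ext] is the junk value 0, for which the
   identity is trivial. *)
have comm y : tpure t (star (S i0)) 1 * h y * tpure t (S i0) 1
    = tpure t (S i0) 1 * (tpure t (star (S i0)) 1 * h y).
  rewrite /h /hmap_alg /tensor_ext; case: xgetP => [F _ [Fl Fc Fp]|_]; last first.
    by rewrite !mulr0 mul0r.
  pose L (v : T) := tpure t (star (S i0)) 1 * v.
  move: y; apply: (@cspan_eq R (htens t (euclid_hilb R n) B) T _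
    (fun y => L (F y) * tpure t (S i0) 1) (fun y => tpure t (S i0) 1 * L (F y))
    (ext_tensor_dense (hpureP t (euclid_hilb R n) B))).
  - exact: linear_map_comp (linear_mull _) (linear_map_comp (linear_mulr _) Fl).
  - exact: linear_map_comp (linear_mulr _) (linear_map_comp (linear_mulr _) Fl).
  - apply: continuous_comp_all (@continuous_mull _ _ _) _.
    exact: continuous_comp_all (@continuous_mulr _ _ _) Fc.
  - apply: continuous_comp_all (@continuous_mulr _ _ _) _.
    exact: continuous_comp_all (@continuous_mulr _ _ _) Fc.
  move=> _ [x [b ->]]; rewrite /L Fp -!tpureM skE !mulr1 !mul1r.
  by rewrite -scalerAl -scalerAr mul1r mulr1.
(* For this vector [h] returns [rho (S i0)], so [comm] says that [u] commutes with [S i0] tensored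
   with 1. *)
have := comm (lambda (delta_mx 0 i0 : 'rV[K]_n)).
rewrite /h -rhoE kEe rhoS.
have -> : tpure t (star (S i0)) 1 * (tpure t (S i0) 1 * u) = u.
  by rewrite mulrA -tpureM cuntz_orth eqxx mulr1 tpure11 mul1r.
(* The left factor removes [S i0]; the right factor selects the block [z i1] of [u], while the other
   side carries [z i0]. *)
move=> /(congr1 (fun x => tpure t (star (S i0)) 1 * x * tpure t (P i1) 1)).
rewrite (mulrA _ _ u) -tpureM cuntz_orth eqxx mulr1 tpure11 mul1r cuntz_unitary_proj.
(* The range of [S i0] lies under [P i0], where [u] acts as [z i0]. *)
have -> : u * tpure t (S i0) 1 = tpure t (S i0) (z i0).
  have SP : S i0 = P i0 * S i0 by rewrite -mulrA cuntz_orth eqxx mulr1.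
  rewrite [in LHS]SP -[1 in LHS]mulr1 tpureM mulrA cuntz_unitary_proj -tpureM.
  by rewrite mulr1 -SP.
(* What remains is [P i1] tensored with [z i0 - z i1] equal to 0; as [P i1] is nonzero, the two
   coordinate functions would coincide. *)
rewrite -!tpureM cuntz_orth eqxx !mul1r mulr1 => /eqP; rewrite -subr_eq0.
rewrite -(linear_mapB (tpure_linr _ _)) => /eqP /(tpure_inj (cuntz_proj_neq0 i1)).
by move=> /eqP; rewrite subr_eq0 => /eqP /torus_coord_inj.
Qed.

End TorusAction.

Theorem theorem1p4 (R : realType) (n : nat) (hn : (2 <= n)%N)
    (t : tensorProduct R)
    (Delta : torusAlg R n -> tens t (torusAlg R n) (torusAlg R n))
    (hDelta : is_quantum_group Delta)
    (hz : forall i : 'I_n,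
      Delta (torus_coord R i) = tpure t (torus_coord R i) (torus_coord R i))
    (O : cstarAlg R) (S : 'I_n -> O) (hO : is_cuntz S) :
  exists rho : O -> tens t O (torusAlg R n),
    [/\ is_action Delta rho,
        (forall i, rho (S i) = tpure t (S i) 1 * cuntz_unitary t S),
        (forall rho' : O -> tens t O (torusAlg R n), unital_star_hom rho' ->
           (forall i, rho' (S i) = tpure t (S i) 1 * cuntz_unitary t S) ->
           rho' = rho)
      & ~ is_lift Delta (@cuntz_phi R n) (cuntz_kE S) (@cuntz_kA R O) rho].
Proof.
(* Universality for the twisted Cuntz family yields both [rho] and its uniqueness. *)
have [rho [[rhoh rhoS] rhou]] := cuntz_universal hO (torus_action_relations t hO).
exists rho; split => //.
- split => //; last exact: (torus_action_dense hO rhoh rhoS).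
  by move=> a; exact: (torus_action_coassoc hO rhoh rhoS _ (qgroup_hom hDelta)).
- by move=> rho' rhoh' rhoS'; apply/esym; apply: rhou; split.
- exact: torus_action_not_lift.
Qed.
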